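(* Let $q\ge1$ and $d\ge 1$, and let $\mathcal{D}=\{(b_1,B_1),\ldots,(b_d,B_d)\}\subseteq[q]\times 2^{[q]}$ with $|B_j|\ge2$ for all $j$. Let $I\subseteq R=\mathsf k[x_1,\ldots,x_n]$ be a square-free monomial ideal with minimal monomial generators $m_1,\ldots,m_q$ satisfying $m_{b}\mid\mathrm{lcm}(m_i:i\in B)$ for all $(b,B)\in\mathcal{D}$. Then for all integers $r\ge1$ and $i\ge 0$: (1) if a simplicial complex $\Delta$ supports a free resolution of $\mathcal{E}_{\mathcal{D}}^r$, then $\psi_I(\Delta)$ supports a free resolution of $I^r$; (2) if $\mathbf m\in\mathrm{LCM}(I^r)$, then $\beta_{i,\mathbf m}(I^r)\le \sum_{\varepsilon\in \mathrm{LCM}(\mathcal{E}_{\mathcal{D}}^r),\ \psi_I(\varepsilon)=\mathbf m}\beta_{i,\varepsilon}(\mathcal{E}_{\mathcal{D}}^r)$; (3) $\beta_i(I^r)\le\beta_i(\mathcal{E}_{\mathcal{D}}^r)$.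
   Context: $\mathcal{D}$-extremal ideals. Let $\mathsf k$ be a field and $S_{[q]}=\mathsf k[y_A:\emptyset\ne A\subseteq[q]]$. For $\mathcal{D}\subseteq [q]\times(2^{[q]}\smallsetminus\{\emptyset\})$ let $Q(\mathcal{D})=\{A\subseteq[q]: A\ne\emptyset,\ A\cap B\ne\emptyset \text{ for all }(b,B)\in\mathcal{D}\text{ with } b\in A\}$, $\varepsilon_{\mathcal{D},i}=\prod_{A\in Q(\mathcal{D}),\, i\in A} y_A$ for $i\in[q]$, and $\mathcal{E}_{\mathcal{D}}=(\varepsilon_{\mathcal{D},1},\ldots,\varepsilon_{\mathcal{D},q})\subseteq S_{[q]}$. For $\mathbf a=(a_1,\dots,a_q)\in\mathcal N^r_q=\{\mathbf a\in\mathbb N^q: a_1+\dots+a_q=r\}$ write $\varepsilon_{\mathcal{D}}^{\mathbf a}=\prod_i\varepsilon_{\mathcal{D},i}^{a_i}$ and $\mathbf m^{\mathbf a}=\prod_i m_i^{a_i}$. The map $\psi_I$. For $k\in[n]$ let $\mathcal A_k=\{j\in[q]: x_k\mid m_j\}$. $\psi_I:S_{[q]}\to R$ is the $\mathsf k$-algebra homomorphism with $\psi_I(y_A)=\prod_{k\in[n],\,\mathcal A_k=A}x_k$ if $A=\mathcal A_k$ for some $k$, and $\psi_I(y_A)=1$ otherwise. LCM lattice and resolutions. For a monomial ideal $J$ with minimal monomial generating set $G$, $\mathrm{LCM}(J)$ is the lattice of least common multiples of nonempty subsets of $G$, ordered by divisibility. A simplicial complex $\Delta$ whose vertices are labeled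 by monomials generating $J$, each face labeled by the lcm of its vertex labels, supports a free resolution of $J$ if the homogenized (multigraded) simplicial chain complex of $\Delta$ with these labels is a free resolution of $J$. If $\Delta$ has vertices labeled by the minimal generators $\varepsilon_{\mathcal{D}}^{\mathbf a}$ of $\mathcal{E}_{\mathcal{D}}^r$, then $\psi_I(\Delta)$ is the same simplicial complex with each label $\varepsilon$ replaced by $\psi_I(\varepsilon)$ (so each face is labeled by the image of its label). $\beta_{i,\mathbf m}(J)=\dim_{\mathsf k}\mathrm{Tor}_i(J,\mathsf k)_{\mathbf m}$ is the multigraded betti number and $\beta_i(J)=\dim_{\mathsf k}\mathrm{Tor}_i(J,\mathsf k)$ (so $\beta_0(J)$ is the minimal number of generators). *)

(* Defs.v *)
From HB Require Import structures.
From mathcomp Require Import all_boot all_order all_algebra.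
From mathcomp Require Import mpoly.
Set Implicit Arguments. Unset Strict Implicit. Unset Printing Implicit Defensive.
Import GRing.Theory.
Local Open Scope ring_scope.

(* Monomials over a finite set of variables V, as exponent vectors.   *)
Definition mon (V : finType) := {ffun V -> nat}.

Definition mdiv (V : finType) (a b : mon V) : bool := [forall v, a v <= b v]%N.

(* lcm of a finite list of monomials (the lcm of the empty list is 1) *)
Definition monlcm (V : finType) (s : seq (mon V)) : mon V :=
  [ffun v => \max_(a <- s) a v]%N.

Definition mdiff (V : finType) (a b : mon V) : mon V := [ffun v => a v - b v]%N.

Definition monP (k : fieldType) (V : finType) (a : mon V) : {mpoly k[#|V|]} :=
  \prod_(v : V) 'X_(enum_rank v) ^+ a v.

(* monomial ideals are given by a finite list G of generating monomials *)
Definition inIdeal (k : fieldType) (V : finType) (G : seq (mon V))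
    (p : {mpoly k[#|V|]}) : Prop :=
  exists c : 'I_(size G) -> {mpoly k[#|V|]},
    p = \sum_(j < size G) c j * monP k (nth [ffun => 0%N] G j).

(* x^a belongs to the monomial ideal generated by G *)
Definition inJm (V : finType) (G : seq (mon V)) (a : mon V) : bool :=
  has (fun g => mdiv g a) G.

Definition mingens (V : finType) (G : seq (mon V)) : seq (mon V) :=
  undup [seq g <- G | ~~ has (fun h => mdiv h g && (h != g)) G].

Definition LCMset (V : finType) (G : seq (mon V)) : seq (mon V) :=
  let mg := mingens G in
  undup (map (fun X : {set 'I_(size mg)} =>
                 monlcm (map (fun j : 'I_(size mg) => nth [ffun => 0%N] mg j) (enum X)))
              (enum [set X : {set 'I_(size mg)} | X != set0])).

Definition is_simplicial_complex (W : finType) (Delta : {set {set W}}) : Prop :=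
  (forall F G : {set W}, F \in Delta -> G \subset F -> G \in Delta) /\
  (forall w : W, [set w] \in Delta).

Section Homogenized.
Variables (k : fieldType) (V W : finType).
Variables (Delta : {set {set W}}) (lab : W -> mon V).

Definition face_label (F : {set W}) : mon V := monlcm [seq lab w | w in F].

Definition chain := {ffun {set W} -> {mpoly k[#|V|]}}.

Definition is_chain (i : nat) (c : chain) : Prop :=
  forall F, c F != 0 -> (F \in Delta) && (#|F| == i.+1)%N.

Definition fsign (w : W) (F : {set W}) : {mpoly k[#|V|]} :=
  (-1) ^+ #|[set u in F | (enum_rank u < enum_rank w)%N]|.

(* homogenized simplicial boundary:
   d(e_F) = sum_{w in F} sign(w,F) * x^(lab F - lab (F\w)) e_{F\w} *)
Definition bd (c : chain) : chain :=
  [ffun G => \sum_(w in ~: G)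
     c (w |: G) * (fsign w (w |: G) *
                   monP k (mdiff (face_label (w |: G)) (face_label G)))].

Definition aug (c : chain) : {mpoly k[#|V|]} :=
  \sum_(w : W) c [set w] * monP k (lab w).

(* Delta (with labels lab) supports a free resolution of the ideal J
   generated by G: the augmented homogenized chain complex
   ... -> F_1 -> F_0 -> J -> 0 is exact. *)
Definition supports_resolution (G : seq (mon V)) : Prop :=
  (forall p, @inIdeal k V G p <-> exists c, is_chain 0 c /\ aug c = p) /\
  (forall (i : nat) (c : chain), is_chain i c ->
     (if i is 0 then aug c = 0 else bd c = 0) ->
     exists b, is_chain i.+1 b /\ bd b = c).
End Homogenized.

(* Multigraded Betti numbers beta_{i,m}(J) = dim_k Tor_i(J,k)_m,      *)
(* computed as Koszul homology H_i(K(x) (x) J)_m.                     *)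
Section Betti.
Variables (k : fieldType) (V : finType) (G : seq (mon V)).

(* basis element e_S of (K_|S| (x) J)_m: S in supp m and x^(m - e_S) in J *)
Definition kvalid (m : mon V) (X : {set V}) : bool :=
  [forall v in X, (0 < m v)%N] && inJm G [ffun v => (m v - (v \in X))%N].

Definition kmx (i : nat) (m : mon V) : 'M[k]_#|{set V}| :=
  \matrix_(s < #|{set V}|, t < #|{set V}|)
    (let X : {set V} := enum_val s in let T : {set V} := enum_val t in
     if [&& #|X| == i, kvalid m X, T \subset X & #|X :\: T| == 1]%N then
       \sum_(v in X :\: T) (-1) ^+ #|[set u in T | (enum_rank u < enum_rank v)%N]|
     else 0).

Definition betti_m (i : nat) (m : mon V) : nat :=
  (#|[set X : {set V} | (#|X| == i)%N && kvalid m X]|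
     - \rank (kmx i m) - \rank (kmx i.+1 m))%N.

(* total Betti number: sum over all multidegrees; Tor_i(J,k)_m vanishes
   unless m divides the lcm of G, so we sum over a box containing it. *)
Definition bnd : nat := (\max_(g <- G) \max_(v : V) g v)%N.

Definition betti (i : nat) : nat :=
  (\sum_(m : {ffun V -> 'I_bnd.+1}) betti_m i [ffun v => val (m v)])%N.
End Betti.

(* variables y_A of S_[q], A nonempty subset of [q] *)
Definition NE (q : nat) := {A : {set 'I_q} | A != set0}.

Definition inQ (q : nat) (D : {set 'I_q * {set 'I_q}}) (A : {set 'I_q}) : bool :=
  (A != set0) && [forall p in D, (p.1 \in A) ==> (A :&: p.2 != set0)].

Definition eps (q : nat) (D : {set 'I_q * {set 'I_q}}) (i : 'I_q) : mon (NE q) :=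
  [ffun A : NE q => nat_of_bool (inQ D (val A) && (i \in val A))].

Definition Nrq (q r : nat) : seq {ffun 'I_q -> 'I_r.+1} :=
  enum [set a : {ffun 'I_q -> 'I_r.+1} | (\sum_i (val (a i)) == r)%N].

Definition epsX (q r : nat) (D : {set 'I_q * {set 'I_q}}) (a : {ffun 'I_q -> 'I_(r.+1)})
  : mon (NE q) := [ffun A => \sum_i val (a i) * eps D i A]%N.

Definition Egens (q r : nat) (D : {set 'I_q * {set 'I_q}}) : seq (mon (NE q)) :=
  [seq @epsX q r D a | a <- Nrq q r].

Definition mX (q n r : nat) (m : 'I_q -> mon 'I_n) (a : {ffun 'I_q -> 'I_r.+1})
  : mon 'I_n := [ffun x => \sum_i val (a i) * m i x]%N.

Definition Igens (q n r : nat) (m : 'I_q -> mon 'I_n) : seq (mon 'I_n) :=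
  [seq mX m a | a <- Nrq q r].

Definition Ak (q n : nat) (m : 'I_q -> mon 'I_n) (x : 'I_n) : {set 'I_q} :=
  [set j | (0 < m j x)%N].

(* psi_I on monomials: y^e |-> prod_k x_k^(e_{A_k})  (exponent 0 if A_k = empty,
   since then x_k occurs in no psi_I(y_A)) *)
Definition psi (q n : nat) (m : 'I_q -> mon 'I_n) (e : mon (NE q)) : mon 'I_n :=
  [ffun x => if @insub _ (fun A : {set 'I_q} => A != set0) (NE q) (Ak m x)
                is Some A then e A else 0%N].

(* Main.v *)
Require Import Defs.
From HB Require Import structures.
From mathcomp Require Import all_boot all_order all_algebra.
From mathcomp Require Import mpoly.
From mathcomp Require Import zify.

(** The map psi sends monomials to monomials and preserves least common
    multiples, and it sends the generators of E_D^r to those of I^r.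

    Resolutions: for a multidegree u, let u' be the lcm of all face labels whose
    image divides u.  A face label has image dividing u iff it divides u', so a
    multigraded component of a cycle for the labels psi(lab) is a component of a
    cycle for the labels lab in degree u', where it can be filled.

    Betti numbers: the Koszul homology of a monomial ideal in degree m is the
    homology of its Taylor complex restricted to the faces with label exactly m,
    because both are homologies of pieces of one double complex whose other
    pieces carry an acyclic matching.  For the Taylor complex the statement is
    linear algebra: the faces whose label has image m split according to their
    label e, the boundary is block triangular for this splitting, and the rank of
    a block triangular matrix is at least the sum of the ranks of its blocks. *)

Set Implicit Arguments.
Unset Strict Implicit.
Unset Printing Implicit Defensive.

Import GRing.Theory.

(** * Ranks of matrices indexed by a finite type *)

Section BasedComplexes.
Local Open Scope ring_scope.
Context {k : fieldType}.

(** Restriction to a subset of [B] is done by zeroing entries, so that all blocks are square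
    matrices of the same size and can be multiplied and compared directly. *)
Definition bmx (B : finType) (A : B -> B -> k) : 'M[k]_#|B| :=
  \matrix_(s, t) A (enum_val s) (enum_val t).

Lemma sum_enum_val (B : finType) (f : B -> k) :
  \sum_(j < #|B|) f (enum_val j) = \sum_b f b.
Proof.
by rewrite [RHS](reindex _ (onW_bij _ (enum_val_bij B))).
Qed.

Lemma bmx_mul (B : finType) (A A' : B -> B -> k) :
  bmx A *m bmx A' = bmx (fun b c => \sum_x A b x * A' x c).
Proof.
apply/matrixP => s t; rewrite !mxE -(sum_enum_val (B := B)).
by apply: eq_bigr => j _; rewrite !mxE.
Qed.

Lemma bmx_tr (B : finType) (A : B -> B -> k) :
  (bmx A)^T = bmx (fun b c => A c b).
Proof. by apply/matrixP => s t; rewrite !mxE. Qed.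

Lemma eq_bmx (B : finType) (A A' : B -> B -> k) :
  (forall b c, A b c = A' b c) -> bmx A = bmx A'.
Proof. by move=> eqA; apply/matrixP => s t; rewrite !mxE. Qed.

Definition rowfree_on (B : finType) (A : B -> B -> k) (R : {set B}) : Prop :=
  forall c : B -> k, (forall b', \sum_(b in R) c b * A b b' = 0) ->
  forall b, b \in R -> c b = 0.

Lemma sum_enum_val_in (B : finType) (R : {set B}) (f : B -> k) :
  \sum_(j < #|R|) f (enum_val j) = \sum_(b in R) f b.
Proof. by rewrite [RHS]big_enum_val. Qed.

Lemma rowfree_on_rank (B : finType) (A : B -> B -> k) (R : {set B}) :
  rowfree_on A R -> (#|R| <= \rank (bmx A))%N.
Proof.
move=> freeR; pose f (j : 'I_#|R|) := enum_rank (enum_val j).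
suff /eqP <- : row_free (rowsub f (bmx A)).
  by apply: mxrankS; apply: rowsub_sub.
apply: inj_row_free => v /rowP v0; apply/rowP => j; rewrite !mxE.
(* The row vector [v] on the positions of [R] becomes a function on [B]; its value 0 outside [R]
   never enters the sums. *)
pose c b := if insub (index b (enum R)) is Some j' then v 0 j' else 0.
have cE j' : c (enum_val j') = v 0 j'.
  rewrite /c; case: insubP => [j'' _ j''E|]; last first.
    by rewrite [X in (_ < X)%N]cardE index_mem mem_enum enum_valP.
  congr (v 0 _); apply: val_inj; rewrite /= j''E (enum_val_nth (enum_val j')).
  by rewrite index_uniq ?enum_uniq // -cardE.
rewrite -cE; apply: (freeR c) => [b'|]; last exact: enum_valP.
have := v0 (enum_rank b'); rewrite !mxE; apply: etrans.
rewrite -(sum_enum_val_in R); apply: eq_bigr => j' _.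
by rewrite !mxE !enum_rankK cE.
Qed.

Definition rowbasis (B : finType) (A : B -> B -> k) : {set B} :=
  [set enum_val (maxrankfun (bmx A) j) | j in 'I_(\rank (bmx A))].

Lemma card_rowbasis (B : finType) (A : B -> B -> k) :
  #|rowbasis A| = \rank (bmx A).
Proof.
rewrite card_imset ?card_ord // => i j /enum_val_inj.
exact: maxrankfun_inj.
Qed.

Lemma rowbasis_free (B : finType) (A : B -> B -> k) :
  rowfree_on A (rowbasis A).
Proof.
move=> c c0 _ /imsetP[j _ ->].
set f := maxrankfun (bmx A) in c0 *.
pose v : 'rV_(\rank (bmx A)) := \row_j c (enum_val (f j)).
suff : v = 0 by move/rowP/(_ j); rewrite !mxE.
have /row_free_inj : row_free (rowsub f (bmx A)) by apply: maxrowsub_free.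
apply; rewrite mul0mx; apply/rowP => t; rewrite !mxE -[RHS](c0 (enum_val t)).
rewrite big_imset /= => [|x y _ _ /enum_val_inj /maxrankfun_inj //].
by apply: eq_bigr => x _; rewrite !mxE.
Qed.

Lemma sum_card_classes (B : finType) (E : eqType) (cls : B -> E)
    (P : {set B}) (s : seq E) :
  uniq s -> (forall b, b \in P -> cls b \in s) ->
  (\sum_(e <- s) #|[set b in P | cls b == e]|)%N = #|P|.
Proof.
move=> us Ps; rewrite -sum1_card.
under eq_bigr => e _ do
  (rewrite -sum1_card; under eq_bigl => b do rewrite inE; rewrite big_mkcondr).
rewrite exchange_big /=; apply: eq_bigr => b /Ps bs.
rewrite -big_mkcond /= (eq_bigl (pred1 (cls b))) => [|e /=]; last exact: eq_sym.
by rewrite sum1_count count_uniq_mem // bs.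
Qed.

(* Bases of the row spaces of the diagonal blocks stay independent together:
   in a linear relation, look at the rows of maximal level. *)
Lemma rank_ge_blocks (B : finType) (E : eqType) (cls : B -> E) (lev : E -> nat)
    (A : B -> B -> k) (s : seq E) :
  (forall b c, A b c != 0 -> cls b = cls c \/ (lev (cls c) < lev (cls b))%N) ->
  uniq s ->
  (\sum_(e <- s)
     \rank (bmx (fun b c => if (cls b == e) && (cls c == e) then A b c else 0%R))
   <= \rank (bmx A))%N.
Proof.
move=> Alev us; pose Ae e b c := if (cls b == e) && (cls c == e) then A b c else 0.
(* A row of another class vanishes in the block [Ae e], hence cannot be a member of an independent
   set of rows. *)
have Re e b : b \in rowbasis (Ae e) -> cls b = e.
  move=> bR; apply/eqP; case: eqVneq => // be.
  suff /(rowbasis_free (A := Ae e))/(_ b bR)/eqP :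
      forall b', \sum_(x in rowbasis (Ae e)) (x == b)%:R * Ae e x b' = 0.
    by rewrite eqxx oner_eq0.
  move=> b'; apply: big1 => x _.
  by rewrite /Ae; case: eqVneq => [->|_]; rewrite ?(negPf be) ?mulr0 ?mul0r.
pose R := [set b | (cls b \in s) && (b \in rowbasis (Ae (cls b)))].
have -> : (\sum_(e <- s) \rank (bmx (Ae e)))%N = #|R|.
  rewrite -(sum_card_classes us (cls := cls) (P := R)) => [|b]; last first.
    by rewrite inE => /andP[].
  rewrite [LHS]big_seq [RHS]big_seq; apply: eq_bigr => e es.
  rewrite -card_rowbasis; apply: eq_card => b; rewrite !inE.
  apply/idP/idP => [bR|/andP[/andP[_ bR] /eqP <-] //].
  by rewrite (Re _ _ bR) es bR eqxx.
apply: rowfree_on_rank => c c0 b1 b1R; apply/eqP/negP => /negP cb1.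
have P1 : (b1 \in R) && (c b1 != 0) by rewrite b1R.
have [b0 /andP[b0R cb0] max0] :=
  arg_maxnP (P := fun b => (b \in R) && (c b != 0)) (fun b => lev (cls b)) P1.
move: (b0R); rewrite inE => /andP[b0s b0B].
suff /rowbasis_free /(_ _ b0B) /eqP :
    forall b', \sum_(b in rowbasis (Ae (cls b0))) c b * Ae (cls b0) b b' = 0.
  by rewrite (negPf cb0).
move=> b'; have [b'0|b'0] := eqVneq (cls b') (cls b0); last first.
  by apply: big1 => b _; rewrite /Ae (negPf b'0) andbF mulr0.
rewrite -[RHS](c0 b') big_mkcond [RHS]big_mkcond; apply: eq_bigr => b _ /=.
rewrite [in RHS]inE; case: ifP => [bR|bR].
  by rewrite (Re _ _ bR) b0s bR /Ae (Re _ _ bR) b'0 eqxx.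
(* A row of [R] outside the basis of this block could meet the column [b'] only from a strictly
   higher level, against the maximality of [b0]. *)
case: ifP => // /andP[bs bB].
have [->|cb] := eqVneq (c b) 0; first by rewrite mul0r.
have [->|/Alev] := eqVneq (A b b') 0; first by rewrite mulr0.
rewrite b'0 => -[bb0|]; first by rewrite -bb0 bB in bR.
have := max0 b; rewrite inE bs bB cb => /(_ isT) /=.
by rewrite leqNgt => /negPf->.
Qed.

(** The rows [R] and columns [g b] form a triangular matrix with nonzero diagonal: in a linear
    relation, the column of a row [b0] of maximal level isolates the coefficient of [b0]. *)
Lemma rank_ge_triangular (B : finType) (A : B -> B -> k) (R : {set B})
    (g : B -> B) (lev : B -> nat) :
  (forall b, b \in R -> A b (g b) != 0) ->
  (forall b c, b \in R -> c \in R -> A b (g c) != 0 ->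
     b = c \/ (lev c < lev b)%N) ->
  (#|R| <= \rank (bmx A))%N.
Proof.
move=> diagA triA; apply: rowfree_on_rank => c c0 b1 b1R.
apply/eqP/negP => /negP cb1.
have P1 : (b1 \in R) && (c b1 != 0) by rewrite b1R.
have [b0 /andP[b0R cb0] max0] :=
  arg_maxnP (P := fun b => (b \in R) && (c b != 0)) lev P1.
have := c0 (g b0); rewrite (bigD1 b0) //= big1 => [|b /andP[bR bb0]].
  by move/eqP; rewrite addr0 mulf_eq0 (negPf cb0) (negPf (diagA _ b0R)).
have [->|cb] := eqVneq (c b) 0; first by rewrite mul0r.
have [->|/triA] := eqVneq (A b (g b0)) 0; first by rewrite mulr0.
case=> // [bE|]; first by rewrite bE eqxx in bb0.
by have := max0 b; rewrite bR cb => /(_ isT) /=; rewrite leqNgt => /negPf->.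
Qed.

Lemma rank_bmx_diag (B : finType) (P : {set B}) :
  (\rank (bmx (fun b c => ((b == c) && (b \in P))%:R%R)) <= #|P|)%N.
Proof.
have -> : bmx (fun b c => ((b == c) && (b \in P))%:R) =
    \sum_(b in P) delta_mx (enum_rank b) (enum_rank b).
  apply/matrixP => s t; rewrite !mxE summxE.
  under eq_bigr => b _ do rewrite mxE.
  rewrite big_mkcond (bigD1 (enum_val s)) //= enum_valK eqxx /= big1 => [|b].
    rewrite addr0 -(inj_eq enum_val_inj) eq_sym andbC.
    by case: (_ \in P).
  rewrite -(inj_eq enum_rank_inj) enum_valK eq_sym => /negPf->.
  by case: ifP.
rewrite -[X in (_ <= X)%N]sum1_card.
elim/big_rec2: _ => [|b x y _ le_yx]; first by rewrite mxrank0.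
by apply: leq_trans (mxrank_add _ _) _; rewrite mxrank_delta leq_add2l.
Qed.

(** Let [Y] be the part of the row space of [A] killed by [P1]. It is fixed by [P2] and killed by
    [A'], so Frobenius' inequality gives rank Y + rank (P2 A') <= rank P2, while rank A = rank (A
    P1) + rank Y. *)
Lemma rank_split_le (N : nat) (A A' P1 P2 : 'M[k]_N) :
  A *m A' = 0 -> A = A *m P1 + A *m P2 ->
  (\rank A + \rank (P2 *m A') <= \rank (A *m P1) + \rank P2)%N.
Proof.
move=> AA' AP; have := mxrank_mul_ker A P1; set Y := (A :&: kermx P1)%MS => rkA.
have /submxP[Z YZ] : (Y <= A)%MS by apply: capmxSl.
have YP1 : Y *m P1 = 0 by apply/sub_kermxP; apply: capmxSr.
have YP2 : Y *m P2 = Y.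
  by rewrite [RHS]YZ [in RHS]AP mulmxDr !mulmxA -YZ YP1 add0r.
have := mxrank_Frobenius Y P2 A'; rewrite YP2 YZ -mulmxA AA' mulmx0 mxrank0 -YZ.
by lia.
Qed.

End BasedComplexes.

(** * Homology of subquotients of a based complex *)

Section SubquotientHomology.
Local Open Scope ring_scope.
Context {k : fieldType} {B : finType} (d : B -> B -> k) (deg : B -> nat).
Hypothesis d_deg : forall b c, d b c != 0 -> deg b = (deg c).+1.

Definition layer (P : {set B}) (i : nat) : {set B} := [set b in P | deg b == i].

Definition rkd (P : {set B}) (i : nat) : nat :=
  \rank (bmx (fun b c =>
    if [&& b \in P, c \in P & deg b == i] then d b c else 0%R)).

Definition hdim (P : {set B}) (i : nat) : nat :=
  (#|layer P i| - rkd P i - rkd P i.+1)%N.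

(** The vanishing of [hdim] in every degree, written without truncated subtraction. *)
Definition acyclic_on (P : {set B}) : Prop :=
  forall i, (#|layer P i| <= rkd P i + rkd P i.+1)%N.

Section SubQuotient.
(** The setting of a short exact sequence: by [subS] the boundary maps [S] into itself, so [S] spans
    a subcomplex of [S :|: Q] with quotient spanned by [Q]. *)
Variables (S Q : {set B}).
Hypothesis disjSQ : [disjoint S & Q].
Hypothesis subS : forall b c, b \in S -> c \in Q -> d b c = 0.
Hypothesis dd0 : forall b b', b \in S :|: Q -> b' \in S :|: Q ->
  \sum_(c in S :|: Q) d b c * d c b' = 0.

Let dmx (P : {set B}) i : 'M[k]_#|B| :=
  bmx (fun b c => if [&& b \in P, c \in P & deg b == i] then d b c else 0).

Let proj (P : {set B}) : 'M[k]_#|B| := bmx (fun b c => ((b == c) && (b \in P))%:R).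

Lemma mulmx_proj (A : B -> B -> k) P :
  bmx A *m proj P = bmx (fun b c => if c \in P then A b c else 0).
Proof.
rewrite bmx_mul; apply: eq_bmx => b c.
rewrite (bigD1 c) //= big1 => [|x xc]; last by rewrite (negPf xc) mulr0.
by rewrite eqxx addr0; case: (c \in P); rewrite ?mulr1 ?mulr0.
Qed.

Lemma mul_proj_mx (A : B -> B -> k) P :
  proj P *m bmx A = bmx (fun b c => if b \in P then A b c else 0).
Proof.
rewrite bmx_mul; apply: eq_bmx => b c.
rewrite (bigD1 b) //= big1 => [|x xb]; last by rewrite eq_sym (negPf xb) mul0r.
by rewrite eqxx addr0; case: (b \in P); rewrite ?mul1r ?mul0r.
Qed.

Lemma notinSQ b : b \in S -> (b \in Q) = false.
Proof. exact: disjointFr disjSQ. Qed.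

Lemma notinQS b : b \in Q -> (b \in S) = false.
Proof. exact: disjointFl disjSQ. Qed.

Lemma dmx_dmx j : dmx (S :|: Q) j.+1 *m dmx (S :|: Q) j = 0.
Proof.
rewrite bmx_mul; apply/matrixP => s t; rewrite !mxE.
set b := enum_val s; set c := enum_val t.
have [bC|bC] := boolP (b \in S :|: Q); last first.
  by apply: big1 => x _; rewrite mul0r.
have [cC|cC] := boolP (c \in S :|: Q); last first.
  by apply: big1 => x _; rewrite !andbF mulr0.
have [/eqP bj|bj] := boolP (deg b == j.+1); last first.
  by apply: big1 => x _; rewrite !andbF mul0r.
rewrite -[RHS](dd0 bC cC) [RHS]big_mkcond; apply: eq_bigr => x _ /=.
case xC: (x \in S :|: Q) => /=; last by rewrite !mul0r.
have [->|/d_deg] := eqVneq (d b x) 0; first by rewrite !mul0r.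
by rewrite bj => -[<-]; rewrite eqxx.
Qed.

Lemma rank_proj P : (\rank (proj P) <= #|P|)%N.
Proof. exact: rank_bmx_diag. Qed.

(* A boundary with no [Q]-component is a cycle of [S]; [rkd_sub_le] is the dual
   statement, obtained by transposing. *)
Lemma rkd_quot_le j :
  (rkd (S :|: Q) j.+1 + rkd S j <= rkd Q j.+1 + #|layer S j|)%N.
Proof.
(* A boundary from degree j+1 lies in degree j, so its part outside [Q] is supported on
   [layer S j]. *)
have split_dmx : dmx (S :|: Q) j.+1 = dmx (S :|: Q) j.+1 *m proj Q +
    dmx (S :|: Q) j.+1 *m proj (layer S j).
  rewrite !mulmx_proj; apply/matrixP => s t; rewrite !mxE !inE.
  set b := enum_val s; set c := enum_val t.
  case: ifP => [/and3P[bC cC /eqP bj]|_]; last by rewrite !if_same addr0.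
  have [->|/d_deg] := eqVneq (d b c) 0; first by rewrite !if_same addr0.
  rewrite bj => -[<-]; rewrite eqxx andbT.
  case/orP: cC => cC; first by rewrite cC (notinSQ cC) add0r.
  by rewrite cC (notinQS cC) addr0.
have := rank_split_le (dmx_dmx j) split_dmx.
have -> : proj (layer S j) *m dmx (S :|: Q) j = dmx S j.
  rewrite mul_proj_mx; apply: eq_bmx => b c; rewrite !inE.
  case bS: (b \in S) => //=; case: (deg b == j); rewrite /= ?andbF //.
  rewrite !andbT; case cS: (c \in S) => //=.
  by case: ifP => // cQ; rewrite subS.
have -> : dmx (S :|: Q) j.+1 *m proj Q = dmx Q j.+1.
  rewrite mulmx_proj; apply: eq_bmx => b c; rewrite !inE.
  case cQ: (c \in Q); rewrite ?andbF // orbT /=.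
  case bQ: (b \in Q); rewrite ?orbT ?orbF //=.
  by case bS: (b \in S) => //=; rewrite subS // if_same.
by move/leq_trans; apply; rewrite leq_add2l rank_proj.
Qed.

Lemma rkd_sub_le j :
  (rkd (S :|: Q) j + rkd Q j.+1 <= rkd S j + #|layer Q j|)%N.
Proof.
have split_dmx : (dmx (S :|: Q) j)^T = (dmx (S :|: Q) j)^T *m proj S +
    (dmx (S :|: Q) j)^T *m proj (layer Q j).
  rewrite !bmx_tr !mulmx_proj; apply/matrixP => s t; rewrite !mxE !inE.
  set b := enum_val t; set c := enum_val s.
  case: ifP => [/and3P[bC cC /eqP bj]|_]; last by rewrite !if_same addr0.
  rewrite bj eqxx andbT.
  case/orP: bC => bC; first by rewrite bC (notinSQ bC) addr0.
  by rewrite bC (notinQS bC) add0r.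
have dmxT0 : (dmx (S :|: Q) j)^T *m (dmx (S :|: Q) j.+1)^T = 0.
  by rewrite -trmx_mul dmx_dmx trmx0.
have := rank_split_le dmxT0 split_dmx.
have -> : proj (layer Q j) *m (dmx (S :|: Q) j.+1)^T = (dmx Q j.+1)^T.
  rewrite !bmx_tr mul_proj_mx; apply: eq_bmx => c b; rewrite !inE.
  case cQ: (c \in Q); rewrite ?andbF // ?orbT /=.
  have [->|/d_deg bj] := eqVneq (d b c) 0; first by rewrite !if_same.
  rewrite bj eqSS; case: (deg c == j); rewrite ?andbF ?andbT //.
  case bQ: (b \in Q); rewrite ?orbT ?orbF //=.
  by case bS: (b \in S) => //=; rewrite subS.
have -> : (dmx (S :|: Q) j)^T *m proj S = (dmx S j)^T.
  rewrite !bmx_tr mulmx_proj; apply: eq_bmx => c b; rewrite !inE.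
  case bS: (b \in S) => //=.
  case cS: (c \in S) => //=.
  by case cQ: (c \in Q) => //=; rewrite subS // if_same.
by rewrite !mxrank_tr; move/leq_trans; apply; rewrite leq_add2l rank_proj.
Qed.

(** The boundary is block triangular for membership in [Q]: elements of [Q] may have boundary in
    [S], but not conversely. *)
Lemma rkd_disjointU j : (rkd S j + rkd Q j <= rkd (S :|: Q) j)%N.
Proof.
have := @rank_ge_blocks k B bool (fun b => b \in Q) nat_of_bool
  (fun b c => if [&& b \in S :|: Q, c \in S :|: Q & deg b == j] then d b c else 0)
  [:: false; true].
rewrite big_cons big_seq1 => /(_ _ isT) H.
apply: leq_trans (H _); last first.
  move=> b c; rewrite !inE; case: ifP; last by rewrite eqxx.
  case/and3P => bC cC _ dbc.
  case bQ: (b \in Q); case cQ: (c \in Q) => //; [by left|by right| |by left].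
  by move: bC dbc; rewrite bQ orbF => bS; rewrite subS ?eqxx.
rewrite /rkd /=; apply: eq_leq.
congr (_ + _)%N; congr (\rank _); apply: eq_bmx => b c; rewrite !inE.
  case bS: (b \in S) => /=; last by case: (b \in Q); rewrite //= if_same.
  case cS: (c \in S) => /=; last first.
    by case: (c \in Q); rewrite /= ?andbF // if_same.
  by rewrite (notinSQ bS) (notinSQ cS).
by case bQ: (b \in Q); case cQ: (c \in Q); rewrite ?orbT.
Qed.

Lemma card_layerU i : #|layer (S :|: Q) i| = (#|layer S i| + #|layer Q i|)%N.
Proof.
rewrite -cardsUI [layer S i :&: _](_ : _ = set0) ?cards0 ?addn0.
  by apply: eq_card => b; rewrite !inE andb_orl.
apply/setP => b; rewrite !inE; case bS: (b \in S) => //=.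
by rewrite (notinSQ bS) andbF.
Qed.

(** The connecting isomorphism, by counting. Adding [rkd_quot_le] and [rkd_sub_le] in one degree
    bounds the two total ranks by the layer size, so acyclicity turns both into equalities. Equating
    the two resulting values of the total rank in degree i+1 gives the claim. *)
Lemma hdim_connecting i :
  acyclic_on (S :|: Q) -> hdim Q i.+1 = hdim S i.
Proof.
move=> acC; rewrite /hdim.
have := acC i; have := acC i.+1; rewrite !card_layerU.
have := rkd_quot_le i; have := rkd_quot_le i.+1.
have := rkd_sub_le i; have := rkd_sub_le i.+1; lia.
Qed.

(** Acyclicity of [S] makes [rkd_quot_le] and [rkd_disjointU] meet: in degrees i+1 and i+2 the total
    rank is the sum of the ranks of the two parts, and the contribution of [S] cancels. *)
Lemma hdim_quotient i : acyclic_on S -> hdim (S :|: Q) i.+1 = hdim Q i.+1.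
Proof.
move=> acS; rewrite /hdim !card_layerU.
have := acS i; have := acS i.+1.
have := rkd_quot_le i; have := rkd_quot_le i.+1.
have := rkd_disjointU i.+1; have := rkd_disjointU i.+2; lia.
Qed.

End SubQuotient.

(* Discrete Morse matching: matching [b] with [mu b] exhibits triangular
   submatrices of the boundaries, whose ranks add up to the whole layer. *)
Lemma acyclic_matching (P : {set B}) (up : pred B) (mu : B -> B)
    (lev : B -> nat) :
  (forall b, b \in P -> [/\ mu b \in P, mu (mu b) = b & up (mu b) = ~~ up b]) ->
  (forall b, b \in P -> up b -> d b (mu b) != 0) ->
  (forall b c, b \in P -> c \in P -> up b -> up c -> d b (mu c) != 0 ->
     b = c \/ (lev c < lev b)%N) ->
  acyclic_on P.
Proof.
move=> muP mu_d mu_tri.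
pose U i := [set b in layer P i | up b].
have leU i : (#|U i| <= rkd P i)%N.
  apply: (rank_ge_triangular (g := mu) (lev := lev)).
    move=> b; rewrite !inE => /andP[/andP[bP bi] ub].
    by have [mbP _ _] := muP b bP; rewrite bP mbP bi mu_d.
  move=> b c; rewrite !inE => /andP[/andP[bP bi] ub] /andP[/andP[cP ci] uc].
  by case: ifP => [_|]; rewrite ?eqxx //; apply: mu_tri.
move=> i; apply: leq_trans (leq_add (leU i) (leU i.+1)).
rewrite -(cardsID [set b | up b]) leq_add //.
  by apply: subset_leq_card; apply/subsetP => b; rewrite !inE.
(* The elements of the layer that are not [up] are sent injectively by [mu] to [up] elements one
   degree higher. *)
rewrite -(card_in_imset (f := mu)) => [|b c]; last first.
  rewrite !inE => /andP[_ /andP[bP _]] /andP[_ /andP[cP _]] bc.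
  have [_ mmb _] := muP b bP; have [_ mmc _] := muP c cP.
  by rewrite -mmb bc mmc.
apply: subset_leq_card; apply/subsetP => _ /imsetP[b + ->]; rewrite !inE.
move=> /andP[ub /andP[bP /eqP bi]]; have [mbP mmb umb] := muP b bP.
rewrite umb ub mbP /= andbT -bi.
apply/eqP; rewrite -[in RHS]mmb; apply: d_deg; apply: mu_d => //.
by rewrite umb.
Qed.

End SubquotientHomology.

(** * Invariance of homology dimensions under an injection of bases *)

Section Embedding.
Local Open Scope ring_scope.

(** With [M] the 0/1 matrix of [f], the two boundaries satisfy A' = M A M^T and A = M^T A' M, the
    latter since [A] is supported on the image of [P']; each rank therefore bounds the other. *)
Lemma hdim_embed (k : fieldType) (B B' : finType) (d : B -> B -> k)
    (d' : B' -> B' -> k) (deg : B -> nat) (deg' : B' -> nat) (f : B' -> B)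
    (P' : {set B'}) i :
  injective f ->
  (forall b c, b \in P' -> c \in P' -> d' b c = d (f b) (f c)) ->
  (forall b, b \in P' -> deg' b = deg (f b)) ->
  hdim d deg (f @: P') i = hdim d' deg' P' i.
Proof.
move=> inj_f d'E deg'E.
have rkE j : rkd d deg (f @: P') j = rkd d' deg' P' j.
  rewrite /rkd; set A := fun b c => _; set A' := fun b c => _.
  have memf b : (f b \in f @: P') = (b \in P') by rewrite mem_imset.
  have AA' b c : A' b c = A (f b) (f c).
    rewrite /A /A' !memf; case bP: (b \in P') => //.
    by case cP: (c \in P') => //=; rewrite d'E // deg'E.
  pose M : 'M[k]_(#|B'|, #|B|) :=
    \matrix_(s, t) (f (enum_val s) == enum_val t)%:R.
  have leA' : bmx A' = M *m bmx A *m M^T.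
    apply/matrixP => s t; rewrite !mxE.
    rewrite (bigD1 (enum_rank (f (enum_val t)))) //= big1 => [|x xt]; last first.
      rewrite !mxE -(inj_eq enum_rank_inj) enum_valK eq_sym (negPf xt).
      by rewrite mulr0.
    rewrite !mxE enum_rankK eqxx mulr1 addr0.
    rewrite (bigD1 (enum_rank (f (enum_val s)))) //= big1 => [|x xt]; last first.
      rewrite !mxE -(inj_eq enum_rank_inj) enum_valK eq_sym (negPf xt).
      by rewrite mul0r.
    by rewrite !mxE !enum_rankK eqxx mul1r addr0 AA'.
  have leA : bmx A = M^T *m bmx A' *m M.
    apply/matrixP => s t; rewrite !mxE.
    have [/imsetP[b bP sE]|sP] := boolP (enum_val s \in f @: P'); last first.
      rewrite {1}/A (negPf sP) /= big1 // => x _; rewrite !mxE big1 ?mul0r // => y _.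
      rewrite !mxE; case: eqP => [ys|_]; last by rewrite mul0r.
      by rewrite /A' -memf ys (negPf sP) mulr0.
    have [/imsetP[c cP tE]|tP] := boolP (enum_val t \in f @: P'); last first.
      rewrite {1}/A (negPf tP) andbF /= big1 // => x _; rewrite !mxE.
      case: eqP => [xt|_]; last by rewrite mulr0.
      rewrite big1 ?mul0r // => y _.
      by rewrite !mxE /A' -[enum_val x \in P']memf xt (negPf tP) andbF mulr0.
    rewrite (bigD1 (enum_rank c)) //= big1 => [|x xt]; last first.
      rewrite !mxE tE (inj_eq inj_f) -(inj_eq enum_rank_inj) enum_valK.
      by rewrite (negPf xt) mulr0.
    rewrite !mxE enum_rankK tE eqxx mulr1 addr0.
    rewrite (bigD1 (enum_rank b)) //= big1 => [|x xt]; last first.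
      rewrite !mxE sE (inj_eq inj_f) -(inj_eq enum_rank_inj) enum_valK.
      by rewrite (negPf xt) mul0r.
    by rewrite !mxE !enum_rankK sE eqxx mul1r addr0 AA'.
  apply/eqP; rewrite eqn_leq; apply/andP; split.
    by rewrite leA (leq_trans (mxrankM_maxl _ _)) ?mxrankM_maxr.
  by rewrite leA' (leq_trans (mxrankM_maxl _ _)) ?mxrankM_maxr.
rewrite /hdim !rkE; congr (_ - _ - _)%N.
rewrite -(card_imset (layer deg' P' i) inj_f); apply: eq_card => b; rewrite !inE.
apply/andP/imsetP => [[/imsetP[x xP ->] xi]|[x]].
  by exists x; rewrite // inE xP deg'E.
by rewrite inE => /andP[xP xi] ->; rewrite mem_imset // xP -deg'E.
Qed.

End Embedding.

(** * The boundary of a simplex and of a product of two simplices *)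

Section SimplexBoundary.
Local Open Scope ring_scope.
Context {k : fieldType}.

Definition face_sign (V : finType) (v : V) (X : {set V}) : k :=
  (-1) ^+ #|[set u in X | (enum_rank u < enum_rank v)%N]|.

(** The empty set counts as a face, so this is the augmented boundary of the full simplex on [V]. *)
Definition sbd (V : finType) (X T : {set V}) : k :=
  \sum_(v in X) if T == X :\ v then face_sign v X else 0.

Lemma sbd_neq0 (V : finType) (X T : {set V}) :
  sbd X T != 0 -> exists2 v, v \in X & T = X :\ v.
Proof.
move=> nz; have [v /andP[vX /eqP TE]|no] := pickP (fun v => (v \in X) && (T == X :\ v)).
  by exists v.
case/eqP: nz; apply: big1 => v vX.
by have := no v; rewrite vX /= => ->.
Qed.

Lemma setD1_inj (V : finType) (X : {set V}) v w :
  v \in X -> X :\ v = X :\ w -> v = w.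
Proof.
by move=> vX /setP/(_ v); rewrite !inE eqxx vX andbT /=; case: eqVneq.
Qed.

Lemma sbd_setD1 (V : finType) (X : {set V}) v :
  v \in X -> sbd X (X :\ v) = face_sign v X.
Proof.
move=> vX; rewrite /sbd (bigD1 v) //= eqxx big1 ?addr0 // => w /andP[_ wv].
by case: eqP => // /setD1_inj-/(_ vX) vw; rewrite vw eqxx in wv.
Qed.

(** Deleting the earlier vertex [v] shifts the position of [w] by one; deleting [w] leaves the
    position of [v] unchanged. *)
Lemma face_sign_anti (V : finType) (v w : V) (X : {set V}) :
  v \in X -> w \in X -> (enum_rank v < enum_rank w)%N ->
  face_sign w X * face_sign v (X :\ w) = - (face_sign v X * face_sign w (X :\ v)).
Proof.
move=> vX wX vw; rewrite /face_sign.
have -> : [set u in X :\ w | (enum_rank u < enum_rank v)%N] =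
          [set u in X | (enum_rank u < enum_rank v)%N].
  apply/setP => u; rewrite !inE; case: eqP => [->|//].
  by rewrite /= ltnNge (ltnW vw) /= andbF.
rewrite (cardsD1 v [set u in X | (enum_rank u < enum_rank w)%N]) inE vX vw /=.
have -> : [set u in X | (enum_rank u < enum_rank w)%N] :\ v =
          [set u in X :\ v | (enum_rank u < enum_rank w)%N].
  by apply/setP => u; rewrite !inE andbA.
by rewrite add1n exprS mulN1r mulNr mulrC.
Qed.

Lemma sum_antisym_eq0 (V : finType) (X : {set V}) (f : V -> V -> k) :
  (forall v w, v \in X -> w \in X -> (enum_rank v < enum_rank w)%N ->
     f w v = - f v w) ->
  \sum_(v in X) \sum_(w in X :\ v) f v w = 0.
Proof.
move=> anti.
have -> : \sum_(v in X) \sum_(w in X :\ v) f v w =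
   \sum_(v in X) \sum_(w in X | (enum_rank v < enum_rank w)%N) f v w +
   \sum_(v in X) \sum_(w in X | (enum_rank w < enum_rank v)%N) f v w.
  rewrite -big_split; apply: eq_bigr => v vX /=.
  rewrite (bigID (fun w => (enum_rank v < enum_rank w)%N)) /=.
  congr (_ + _); apply: eq_bigl => w; rewrite !inE andbC.
    case: (w \in X); rewrite ?andbF // !andbT.
    by case: eqP => [->|]; rewrite ?ltnn ?andbT.
  rewrite -leqNgt leq_eqVlt (inj_eq val_inj) (inj_eq enum_rank_inj).
  by case: (w \in X); rewrite ?andbF //; case: eqP => [->|_]; rewrite ?ltnn ?andbT.
have -> : \sum_(v in X) \sum_(w in X | (enum_rank w < enum_rank v)%N) f v w =
    \sum_(v in X) \sum_(w in X | (enum_rank v < enum_rank w)%N) f w v.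
  rewrite (exchange_big_dep (mem X)) /= => [|v w _ /andP[] //].
  by apply: eq_bigr => v vX; apply: eq_bigl => w; rewrite vX.
rewrite -big_split big1 // => v vX; rewrite -big_split big1 //= => w /andP[wX vw].
by rewrite (anti v w) // addrN.
Qed.

Lemma sbd_sbd (V : finType) (X T : {set V}) : \sum_Y sbd X Y * sbd Y T = 0.
Proof.
pose f v w := if T == X :\ v :\ w then face_sign v X * face_sign w (X :\ v) else 0.
rewrite -[RHS](@sum_antisym_eq0 _ X f) => [|v w vX wX vw]; last first.
  rewrite /f setDDl setUC -setDDl.
  by case: eqP; rewrite ?oppr0 // face_sign_anti.
rewrite /(sbd X); under eq_bigr => Y _ do rewrite mulr_suml.
rewrite exchange_big /=; apply: eq_bigr => v vX.
rewrite (bigD1 (X :\ v)) //= eqxx big1 => [|Y /negPf->]; last by rewrite mul0r.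
rewrite addr0 /sbd mulr_sumr; apply: eq_bigr => w _.
by rewrite /f; case: eqP; rewrite ?mulr0.
Qed.

(** * Tensor product of two augmented simplex complexes *)

Section Product.
Context {V W : finType}.
Let B : finType := ({set V} * {set W})%type.

(** The tensor product differential, with the usual sign (-1)^|X| on the second factor. *)
Definition pbd (b c : B) : k :=
  (if b.2 == c.2 then sbd b.1 c.1 else 0) +
  (-1) ^+ #|b.1| * (if b.1 == c.1 then sbd b.2 c.2 else 0).

Definition pdeg (b : B) : nat := (#|b.1| + #|b.2|)%N.

Lemma pbd_neq0 b c : pbd b c != 0 ->
  (b.2 = c.2 /\ exists2 v, v \in b.1 & c.1 = b.1 :\ v) \/
  (b.1 = c.1 /\ exists2 a, a \in b.2 & c.2 = b.2 :\ a).
Proof.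
case: b c => [X F] [Y H]; rewrite /pbd /=.
have [-> |nFH] := eqVneq F H; last first.
  rewrite add0r mulf_eq0 signr_eq0 /=; have [->|] := eqVneq X Y; last by rewrite eqxx.
  by move=> /sbd_neq0; right.
have [->|/sbd_neq0 XY _] := eqVneq (sbd X Y) 0; last by left.
rewrite add0r mulf_eq0 signr_eq0 /=; have [->|] := eqVneq X Y; last by rewrite eqxx.
by move=> /sbd_neq0; right.
Qed.

Lemma pbd_deg b c : pbd b c != 0 -> pdeg b = (pdeg c).+1.
Proof.
rewrite /pdeg; case/pbd_neq0 => [[-> [v vX ->]]|[-> [a aF ->]]].
  by rewrite (cardsD1 v b.1) vX.
by rewrite (cardsD1 a b.2) aF addnCA.
Qed.

Lemma pbd_pbd b b' : \sum_c pbd b c * pbd c b' = 0.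
Proof.
case: b b' => [X F] [X' F'].
(* The terms [t1] and [t4] use one factor twice and sum to zero by [sbd_sbd]. The mixed sums of [t2]
   and [t3] cancel, because their signs come from sets whose sizes differ by one. *)
pose t1 (c : B) := (if F == c.2 then sbd X c.1 else 0) *
  (if c.2 == F' then sbd c.1 X' else 0).
pose t2 (c : B) := (if F == c.2 then sbd X c.1 else 0) *
  ((-1) ^+ #|c.1| * if c.1 == X' then sbd c.2 F' else 0).
pose t3 (c : B) := ((-1) ^+ #|X| * if X == c.1 then sbd F c.2 else 0) *
  (if c.2 == F' then sbd c.1 X' else 0).
pose t4 (c : B) := ((-1) ^+ #|X| * if X == c.1 then sbd F c.2 else 0) *
  ((-1) ^+ #|c.1| * if c.1 == X' then sbd c.2 F' else 0).
have -> : \sum_c pbd (X, F) c * pbd c (X', F') =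
    \sum_c t1 c + \sum_c t4 c + (\sum_c t2 c + \sum_c t3 c).
  rewrite -!big_split; apply: eq_bigr => c _; rewrite /= addrACA [t4 c + _]addrC.
  by rewrite /pbd mulrDl !mulrDr.
have -> : \sum_c t1 c = 0.
  rewrite -(pair_bigA _ (fun Y H => t1 (Y, H))) exchange_big /= big1 // => H _.
  rewrite /t1 /=; case: eqP => [FH|_]; last by apply: big1 => *; rewrite mul0r.
  case: eqP => [HF'|_]; last by apply: big1 => *; rewrite mulr0.
  exact: sbd_sbd.
have -> : \sum_c t4 c = 0.
  rewrite -(pair_bigA _ (fun Y H => t4 (Y, H))) big1 //= => Y _; rewrite /t4 /=.
  case: eqP => [XY|_]; last by apply: big1 => *; rewrite mulr0 mul0r.
  case: eqP => [HF'|_]; last by apply: big1 => *; rewrite !mulr0.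
  under eq_bigr => H _ do rewrite mulrACA.
  by rewrite -mulr_sumr sbd_sbd mulr0.
have -> : \sum_c t2 c = (-1) ^+ #|X'| * (sbd X X' * sbd F F').
  rewrite (bigD1 (X', F)) //= /t2 /= !eqxx big1 ?addr0 => [|[Y H] /=].
    by rewrite mulrCA.
  rewrite xpair_eqE; case: eqP => [YX'|_]; last by rewrite !mulr0.
  by rewrite eq_sym /= => /negPf ->; rewrite mul0r.
have -> : \sum_c t3 c = (-1) ^+ #|X| * (sbd X X' * sbd F F').
  rewrite (bigD1 (X, F')) //= /t3 /= !eqxx big1 ?addr0 => [|[Y H] /=].
    by rewrite -mulrA [sbd F _ * _]mulrC.
  rewrite xpair_eqE eq_sym; case: eqP => [YX'|_]; last by rewrite mulr0 mul0r.
  by rewrite /= => /negPf ->; rewrite mulr0.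
rewrite !add0r; have [->|/sbd_neq0[v vX ->]] := eqVneq (sbd X X') 0.
  by rewrite mul0r !mulr0 addr0.
by rewrite (cardsD1 v X) vX exprS mulN1r mulNr addrN.
Qed.

End Product.

End SimplexBoundary.

(** * Koszul and Taylor homology of a monomial ideal *)

Section Monomials.
Context {V : finType}.
Implicit Types (a b u : mon V) (s G : seq (mon V)).

Lemma mdivP a b : reflect (forall v, a v <= b v) (mdiv a b).
Proof. exact: forallP. Qed.

Lemma mdiv_refl a : mdiv a a.
Proof. exact/mdivP. Qed.

Lemma mdiv_trans b a u : mdiv a b -> mdiv b u -> mdiv a u.
Proof.
by move=> /mdivP ab /mdivP bu; apply/mdivP => v; apply: leq_trans (bu v).
Qed.

Lemma mdiv_anti a b : mdiv a b -> mdiv b a -> a = b.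
Proof.
move=> /mdivP ab /mdivP ba; apply/ffunP => v; apply/eqP.
by rewrite eqn_leq ab ba.
Qed.

Lemma mdiv_monlcm s u : mdiv (monlcm s) u = all (fun a => mdiv a u) s.
Proof.
apply/mdivP/allP => [su a sa|su v].
  apply/mdivP => v; apply: leq_trans (su v); rewrite ffunE.
  by apply: leq_bigmax_seq.
by rewrite ffunE; apply/bigmax_leqP_seq => a sa _; move/mdivP: (su a sa).
Qed.

Lemma mdiv_sum_lt a b : mdiv a b -> a != b -> \sum_v a v < \sum_v b v.
Proof.
move=> /mdivP ab nab; have [v nv] : exists v, a v != b v.
  apply/existsP; rewrite -negb_forall; apply: contra nab => /forallP ab'.
  by apply/eqP/ffunP => v; apply/eqP.
rewrite (bigD1 v) //= [X in _ < X](bigD1 v) //= -addSn leq_add //.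
  by rewrite ltn_neqAle nv ab.
by apply: leq_sum => w _; apply: ab.
Qed.

Lemma mingens_sub G : {subset mingens G <= G}.
Proof. by move=> a; rewrite mem_undup mem_filter => /andP[]. Qed.

(** Descent on the total degree: a proper divisor in [G] has smaller degree. *)
Lemma mingens_mdiv G b : b \in G -> exists2 a, a \in mingens G & mdiv a b.
Proof.
have [N] := ubnP (\sum_v b v); elim: N b => // N IH b bN bG.
have [/hasP[h hG /andP[hb nhb]]|min_b] := boolP (has (fun h => mdiv h b && (h != b)) G).
  have [|a aG ah] := IH h _ hG; last by exists a; rewrite ?(mdiv_trans ah).
  exact: leq_trans (mdiv_sum_lt hb nhb) _.
by exists b; rewrite ?mdiv_refl // mem_undup mem_filter min_b.
Qed.

Lemma inJm_mdiv G a b : mdiv a b -> inJm G a -> inJm G b.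
Proof.
move=> ab /hasP[g gG ga]; apply/hasP; exists g => //.
exact: mdiv_trans ga ab.
Qed.

(** The valid sets form a simplicial complex, the upper Koszul complex of the ideal in degree
    [m]. *)
Lemma kvalid_sub G (m : mon V) (X Y : {set V}) :
  Y \subset X -> kvalid G m X -> kvalid G m Y.
Proof.
move=> /subsetP YX /andP[/forall_inP mX GX]; apply/andP; split.
  by apply/forall_inP => v /YX; apply: mX.
apply: inJm_mdiv GX; apply/mdivP => v; rewrite !ffunE leq_sub2l //.
by case vY: (v \in Y) => //; rewrite YX.
Qed.

End Monomials.

Section Toggle.
Context {T : finType}.
Implicit Types (o : option T) (F : {set T}).

(** The involution behind both matchings below. The pivot is an option because it is produced by a
    search with [pick]. *)
Definition toggle o F : {set T} :=
  if o is Some a then if a \in F then F :\ a else a |: F else F.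

Definition has_pivot o F : bool := if o is Some a then a \in F else false.

Lemma toggleK o F : toggle o (toggle o F) = F.
Proof.
case: o => //= a; have [aF|aF] := boolP (a \in F); first by rewrite !inE eqxx setD1K.
by rewrite setU11 setU1K.
Qed.

Lemma has_pivot_toggle a F :
  has_pivot (Some a) (toggle (Some a) F) = ~~ has_pivot (Some a) F.
Proof. by rewrite /=; case aF: (a \in F); rewrite ?inE ?eqxx. Qed.

Lemma toggle_pivot a F : a \in F -> toggle (Some a) F = F :\ a.
Proof. by rewrite /= => ->. Qed.

End Toggle.

(** * The double complex joining Koszul and Taylor homology *)

Section KoszulTaylor.
Local Open Scope ring_scope.
Context {k : fieldType} {V W : finType} (G : seq (mon V)) (g : W -> mon V).
(** Only the generated ideal is prescribed: the family [g] may repeat generators or contain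
    redundant ones, as images of minimal generators under psi can. *)
Hypothesis inJmE : forall u, inJm G u = [exists a, mdiv (g a) u].

Definition label (F : {set W}) : mon V := monlcm [seq g a | a <- enum F].

Lemma mdiv_labelP (F : {set W}) u :
  reflect (forall a, a \in F -> mdiv (g a) u) (mdiv (label F) u).
Proof.
rewrite mdiv_monlcm; apply: (iffP allP) => [Fu a aF|Fu _ /mapP[a aF ->]].
  by apply: Fu; rewrite map_f // mem_enum.
by apply: Fu; rewrite mem_enum in aF.
Qed.

Lemma label_sub (F H : {set W}) : H \subset F -> mdiv (label H) (label F).
Proof.
move=> /subsetP HF; apply/mdiv_labelP => a aH.
by have /mdiv_labelP := mdiv_refl (label F); apply; apply: HF.
Qed.

Variable m : mon V.
Let B : finType := ({set V} * {set W})%type.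
Let shift (X : {set V}) : mon V := [ffun v => (m v - (v \in X))%N].

Lemma kvalidP (X : {set V}) : reflect ((forall v, v \in X -> 0 < m v)%N /\
    exists a, mdiv (g a) (shift X)) (kvalid G m X).
Proof.
rewrite /kvalid inJmE; apply: (iffP andP) => -[mX /existsP aX]; split=> //.
  by move=> v vX; move/forall_inP: mX; apply.
by apply/forall_inP.
Qed.

Lemma shift_sub (X Y : {set V}) : Y \subset X -> mdiv (shift X) (shift Y).
Proof.
move=> /subsetP YX; apply/mdivP => v; rewrite !ffunE leq_sub2l //.
by case vY: (v \in Y) => //; rewrite YX.
Qed.

Lemma shift0 : shift set0 = m.
Proof. by apply/ffunP => v; rewrite ffunE inE subn0. Qed.

Lemma mdiv_shift (X : {set V}) : mdiv (shift X) m.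
Proof. by rewrite -[X in mdiv _ X]shift0; apply: shift_sub; apply: sub0set. Qed.

(* The augmented double complex: the Koszul complex sits at F = set0 and the
   Taylor complex at label F = m, which forces X = set0. *)
Let total : {set B} := [set b : B | kvalid G m b.1 & mdiv (label b.2) (shift b.1)].
Let kos : {set B} := [set b in total | b.2 == set0].
Let pos : {set B} := [set b in total | b.2 != set0].
Let low : {set B} := [set b in pos | label b.2 != m].
Let top : {set B} := [set b in pos | label b.2 == m].

Lemma total_split : kos :|: pos = total.
Proof. by apply/setP => b; rewrite !inE -andb_orr orbN andbT. Qed.

Lemma pos_split : low :|: top = pos.
Proof. by apply/setP => b; rewrite !inE -andb_orr orNb andbT. Qed.

Lemma disjoint_kos_pos : [disjoint kos & pos].
Proof.
rewrite -setI_eq0; apply/eqP/setP => b; rewrite !inE.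
by case: (b.2 == set0); rewrite ?andbF.
Qed.

Lemma disjoint_low_top : [disjoint low & top].
Proof.
rewrite -setI_eq0; apply/eqP/setP => b; rewrite !inE.
by case: (label b.2 == m); rewrite ?andbF.
Qed.

Lemma pbd_sub (b c : B) :
  pbd (k := k) b c != 0 -> c.1 \subset b.1 /\ c.2 \subset b.2.
Proof. by case/pbd_neq0 => [[-> [v _ ->]]|[-> [a _ ->]]]; rewrite subxx subsetDl. Qed.

Lemma total_closed b c : b \in total -> pbd (k := k) b c != 0 -> c \in total.
Proof.
rewrite !inE => /andP[kb lb] /pbd_sub[c1 c2]; rewrite (kvalid_sub c1) //=.
exact: mdiv_trans (label_sub c2) (mdiv_trans lb (shift_sub c1)).
Qed.

(** Convexity of [C] means that no intermediate term of the full sum in [pbd_pbd] is lost by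
    restricting to [C]. *)
Lemma sum_pbd_pbd (C : {set B}) :
  (forall b b' c, b \in C -> b' \in C -> pbd (k := k) b c != 0 ->
     pbd (k := k) c b' != 0 -> c \in C) ->
  forall b b', b \in C -> b' \in C -> \sum_(c in C) pbd b c * pbd c b' = 0 :> k.
Proof.
move=> convC b b' bC b'C; rewrite -[RHS](pbd_pbd b b') big_mkcond.
apply: eq_bigr => c _; case: ifP => // cC.
have [->|bc] := eqVneq (pbd (k := k) b c) 0; first by rewrite mul0r.
have [->|cb'] := eqVneq (pbd (k := k) c b') 0; first by rewrite mulr0.
by rewrite (convC b b') in cC.
Qed.

Lemma setD1_neq (T : finType) (F : {set T}) a : a \in F -> F != F :\ a.
Proof. by move=> aF; apply/eqP => /setP/(_ a); rewrite !inE eqxx aF. Qed.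

Lemma pbd_setD1r (X : {set V}) (F : {set W}) a :
  a \in F -> pbd (k := k) (X, F) (X, F :\ a) != 0.
Proof.
move=> aF; rewrite /pbd /= eqxx (negPf (setD1_neq aF)) add0r.
by rewrite sbd_setD1 // mulf_neq0 ?signr_eq0.
Qed.

Lemma pbd_setD1l (X : {set V}) (F : {set W}) v :
  v \in X -> pbd (k := k) (X, F) (X :\ v, F) != 0.
Proof.
move=> vX; rewrite /pbd /= eqxx (negPf (setD1_neq vX)) mulr0 addr0.
by rewrite sbd_setD1 // signr_eq0.
Qed.

(** For fixed [X] the admissible [F] are all subsets of the set of [a] with [g a] dividing the
    shifted degree. This set is nonempty because [X] is valid, so toggling one of its elements,
    chosen from [X] alone, is a perfect matching. *)
Lemma acyclic_total : acyclic_on (pbd (k := k)) (@pdeg V W) total.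
Proof.
pose o (X : {set V}) := [pick a | mdiv (g a) (shift X)].
have oP b : b \in total -> exists2 a, o b.1 = Some a & mdiv (g a) (shift b.1).
  rewrite !inE => /andP[/kvalidP[_ [a aX]] _]; rewrite /o.
  by case: pickP => [a' ?|/(_ a)]; [exists a'|rewrite aX].
apply: (acyclic_matching (@pbd_deg k V W)
  (up := fun b => has_pivot (o b.1) b.2)
  (mu := fun b => (b.1, toggle (o b.1) b.2)) (lev := fun b => #|b.1|)).
- move=> [X F] bP; have [a /= oX aX] := oP _ bP; rewrite /= oX.
  split; [|by rewrite toggleK|exact: has_pivot_toggle].
  move: bP; rewrite !inE /= => /andP[-> /mdiv_labelP FX] /=.
  apply/mdiv_labelP => a'; case: ifP => _; rewrite !inE.
    by case/andP=> _; apply: FX.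
  by case/orP=> [/eqP->|/FX].
- move=> [X F] bP /=; have [a /= -> _] := oP _ bP => aF.
  by rewrite toggle_pivot // pbd_setD1r.
move=> [X F] [Y H] bP cP /=.
have [a /= oX _] := oP _ bP; have [a' /= oY _] := oP _ cP.
rewrite oX oY /= => aF a'H; rewrite a'H.
(* A move in the [V] direction shrinks [X] and lowers the level; a move in the [W] direction keeps
   [X], hence the pivot, and then forces the two faces to agree. *)
case/pbd_neq0 => /= [[_ [v vX ->]]|[XY [c cF HF]]]; [right|left].
  by rewrite [ltnRHS](cardsD1 v) vX.
move: oY; rewrite -XY oX => -[aa']; rewrite -aa' in a'H HF.
congr (_, _); rewrite -(setD1K aF) -(setD1K a'H) HF.
suff -> : a = c by [].
by apply/eqP; move/setP/(_ a): HF; rewrite !inE eqxx aF andbT /=; case: eqVneq.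
Qed.

(** Here the pivot depends on [F] alone: a variable [v] in which the label of [F] is strictly below
    [m]. This slack is what allows [v] to be put into [X] or taken out of it freely. *)
Lemma acyclic_low : acyclic_on (pbd (k := k)) (@pdeg V W) low.
Proof.
pose o (F : {set W}) := [pick v | (label F v < m v)%N].
have oP b : b \in low -> exists2 v, o b.2 = Some v & (label b.2 v < m v)%N.
  rewrite !inE => /andP[/andP[/andP[_ bX] _] bm]; rewrite /o.
  case: pickP => [v ?|no]; first by exists v.
  case/eqP: bm; apply: mdiv_anti (mdiv_trans bX (mdiv_shift _)) _.
  by apply/mdivP => v; rewrite leqNgt no.
apply: (acyclic_matching (@pbd_deg k V W)
  (up := fun b => has_pivot (o b.2) b.1)
  (mu := fun b => (toggle (o b.2) b.1, b.2)) (lev := fun b => #|b.2|)).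
- move=> [X F] bP; have [v /= oF vF] := oP _ bP; rewrite /= oF.
  split; [|by rewrite toggleK|exact: has_pivot_toggle].
  move: bP; rewrite !inE /= => /andP[/andP[/andP[kX FX] F0] ->].
  rewrite F0 !andbT; case: ifP => vX.
    rewrite (kvalid_sub (subsetDl _ _) kX) /=.
    exact: mdiv_trans FX (shift_sub (subsetDl _ _)).
  have FvX : mdiv (label F) (shift (v |: X)).
    apply/mdivP => w; rewrite [shift _ _]ffunE !inE; case: eqVneq => [->|_] /=.
      by rewrite subn1 -ltnS prednK // (leq_ltn_trans _ vF).
    by move/mdivP/(_ w): FX; rewrite [shift _ _]ffunE.
  rewrite FvX andbT; apply/kvalidP; split.
    move=> w; rewrite !inE => /orP[/eqP->|]; first exact: leq_ltn_trans vF.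
    by case/kvalidP: kX => + _; apply.
  (* A member of the nonempty face [F] supplies the generator that keeps the enlarged set valid. *)
  have [a aF] := set0Pn _ F0; exists a.
  by move/mdiv_labelP: FvX; apply.
- move=> [X F] bP /=; have [a /= -> _] := oP _ bP => aF.
  by rewrite toggle_pivot // pbd_setD1l.
move=> [X F] [Y H] bP cP /=.
have [a /= oX _] := oP _ bP; have [a' /= oY _] := oP _ cP.
rewrite oX oY /= => aF a'H; rewrite a'H.
case/pbd_neq0 => /= [[XY [c cF HF]]|[_ [v vX ->]]]; [left|right].
  move: oY; rewrite -XY oX => -[aa']; rewrite -aa' in a'H HF.
  congr (_, _); rewrite -(setD1K aF) -(setD1K a'H) HF.
  suff -> : a = c by [].
  by apply/eqP; move/setP/(_ a): HF; rewrite !inE eqxx aF andbT /=; case: eqVneq.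
by rewrite [ltnRHS](cardsD1 v) vX.
Qed.

Lemma koszul_total i :
  hdim (@sbd k V) (fun X : {set V} => #|X|) [set X | kvalid G m X] i =
  hdim (pbd (k := k)) (@pdeg V W) kos i.
Proof.
have -> : kos = (fun X : {set V} => (X, set0) : B) @: [set X | kvalid G m X].
  apply/setP => -[X F]; rewrite !inE /=; apply/andP/imsetP.
    by case=> /andP[kX _] /eqP->; exists X; rewrite ?inE.
  case=> Y; rewrite inE => kY [-> ->]; rewrite kY eqxx; split=> //=.
  by apply/mdiv_labelP => a; rewrite inE.
apply/esym/hdim_embed => [X Y [] //|X Y _ _|X _]; last by rewrite /pdeg cards0 addn0.
by rewrite /pbd /= eqxx /(sbd set0) big_set0 if_same mulr0 addr0.
Qed.

Lemma taylor_total i :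
  hdim (@sbd k W) (fun F : {set W} => #|F|)
    [set F | (F != set0) && (label F == m)] i =
  hdim (pbd (k := k)) (@pdeg V W) top i.
Proof.
have -> : top = (fun F : {set W} => (set0, F) : B) @:
    [set F | (F != set0) && (label F == m)].
  apply/setP => -[X F]; rewrite !inE /=; apply/andP/imsetP.
    case=> /andP[/andP[/kvalidP[mX _] FX] F0] /eqP Fm; exists F.
      by rewrite inE F0 Fm eqxx.
    (* A variable [v] in [X] would give m v <= m v - 1 with m v positive. *)
    congr (_, _); apply/setP => v; rewrite inE; apply/negP => vX.
    move/mdivP/(_ v): FX; rewrite Fm ffunE vX subn1 -ltnS prednK ?mX //.
    by rewrite ltnn.
  case=> H; rewrite inE => /andP[H0 /eqP Hm] [-> ->].
  rewrite H0 Hm shift0 mdiv_refl eqxx !andbT; split=> //; apply/kvalidP; split.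
    by move=> v; rewrite inE.
  have [a aH] := set0Pn _ H0; exists a; rewrite shift0 -Hm.
  by have /mdiv_labelP := mdiv_refl (label H); apply.
apply/esym/hdim_embed => [X Y [] //|F H _ _|X _]; last by rewrite /pdeg cards0.
by rewrite /pbd /= eqxx /(sbd set0) big_set0 if_same add0r cards0 mul1r.
Qed.

(** First [kos] is a subcomplex of the acyclic [total] with quotient [pos], which raises the degree
    by one; then [low] is an acyclic subcomplex of [pos] with quotient [top]. The shift reflects
    that a face with i+1 vertices has homological degree i. *)
Lemma koszul_taylor i :
  hdim (@sbd k V) (fun X : {set V} => #|X|) [set X | kvalid G m X] i =
  hdim (@sbd k W) (fun F : {set W} => #|F|)
    [set F | (F != set0) && (label F == m)] i.+1.
Proof.
rewrite koszul_total taylor_total.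
rewrite -(hdim_connecting (@pbd_deg k V W) disjoint_kos_pos) ?total_split; first last.
- exact: acyclic_total.
- by apply: sum_pbd_pbd => b b' c bT _ bc _; apply: total_closed bc.
- move=> b c; rewrite inE => /andP[bT /eqP b0]; rewrite inE => /andP[_ c0].
  apply/eqP/negP => /negP /pbd_sub[_]; rewrite b0 subset0.
  exact/negP.
rewrite -[in LHS]pos_split; apply: (hdim_quotient (@pbd_deg k V W)).
- exact: disjoint_low_top.
- move=> b c; rewrite inE => /andP[bp bm]; rewrite inE => /andP[_ /eqP cm].
  apply/eqP/negP => /negP /pbd_sub[_ cb]; case/eqP: bm; apply: mdiv_anti.
    move: bp; rewrite !inE => /andP[/andP[_ bX] _].
    exact: mdiv_trans bX (mdiv_shift _).
  by rewrite -cm label_sub.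
- rewrite pos_split; apply: sum_pbd_pbd => b b' c; rewrite inE => /andP[bT _].
  rewrite inE => /andP[_ b'0] bc /pbd_sub[_ cb']; rewrite inE (total_closed bT) //=.
  by apply: contraNneq b'0 => c0; rewrite c0 subset0 in cb'.
exact: acyclic_low.
Qed.

End KoszulTaylor.

(** * Betti numbers under an lcm-preserving map *)

Section BettiNumbers.
Context (k : fieldType).

(** Layer sizes add up over the classes, while the rank of the whole boundary is at least the sum of
    the ranks of its diagonal blocks. *)
Lemma hdim_le_blocks (B : finType) (E : eqType) (d : B -> B -> k)
    (deg : B -> nat) (cls : B -> E) (lev : E -> nat) (P : {set B}) (s : seq E) i :
  (forall b c, d b c != 0%R -> cls b = cls c \/ lev (cls c) < lev (cls b)) ->
  uniq s -> (forall b, b \in P -> cls b \in s) ->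
  hdim d deg P i <= \sum_(e <- s) hdim d deg [set b in P | cls b == e] i.
Proof.
move=> d_lev us Ps.
have rk_le j : \sum_(e <- s) rkd d deg [set b in P | cls b == e] j <= rkd d deg P j.
  pose A b c := if [&& b \in P, c \in P & deg b == j] then d b c else 0%R.
  apply: leq_trans (rank_ge_blocks (cls := cls) (lev := lev) (A := A) _ us).
    rewrite leq_eqVlt; apply/orP; left; apply/eqP; apply: eq_bigr => e _.
    congr (\rank _); apply: eq_bmx => b c; rewrite /A !inE.
    by case: (b \in P) (c \in P) (_ == e) (_ == e) => [] [] [] [].
  by move=> b c; rewrite /A; case: ifP => _; rewrite ?eqxx //; apply: d_lev.
have cardP : #|layer deg P i| = \sum_(e <- s) #|layer deg [set b in P | cls b == e] i|.
  rewrite -(sum_card_classes us (cls := cls) (P := layer deg P i)) => [|b].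
    by apply: eq_bigr => e _; apply: eq_card => b; rewrite !inE andbAC.
  by rewrite inE => /andP[/Ps].
rewrite /hdim cardP; have := rk_le i; have := rk_le i.+1.
set r := rkd d deg P i; set r' := rkd d deg P i.+1.
(* This additive form of the dimension count holds class by class in spite of truncated subtraction,
   and can be summed. *)
suff : \sum_(e <- s) #|layer deg [set b in P | cls b == e] i| <=
  \sum_(e <- s) hdim d deg [set b in P | cls b == e] i +
  (\sum_(e <- s) rkd d deg [set b in P | cls b == e] i +
   \sum_(e <- s) rkd d deg [set b in P | cls b == e] i.+1).
  by rewrite /hdim; lia.
rewrite -!big_split; apply: leq_sum => e _ /=; rewrite /hdim; lia.
Qed.

(** The matrix [kmx] counts signs in the smaller set and [sbd] in the larger one; both agree since
    the deleted vertex does not precede itself. *)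
Lemma betti_m_hdim (V : finType) (G : seq (mon V)) i (m : mon V) :
  betti_m k G i m =
  hdim (@sbd k V) (fun X : {set V} => #|X|) [set X | kvalid G m X] i.
Proof.
have entry (j : nat) (X T : {set V}) :
    (if [&& #|X| == j, kvalid G m X, T \subset X & #|X :\: T| == 1%N] then
       \sum_(v in X :\: T) (-1) ^+ #|[set u in T | (enum_rank u < enum_rank v)%N]|
     else 0)%R =
    if [&& kvalid G m X, kvalid G m T & #|X| == j] then sbd X T else 0%R :> k.
  case: (#|X| == j); rewrite ?andbF //= ?andbT.
  case kX: (kvalid G m X) => //=.
  have [TX|nTX] := boolP (T \subset X); last first.
    case: (eqVneq (@sbd k V X T) 0%R) => [->|/sbd_neq0[v _ TE]].
      by rewrite if_same.
    by rewrite TE subsetDl in nTX.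
  rewrite (kvalid_sub TX kX) /=.
  case: ifP => [/cards1P[v XT]|nXT]; last first.
    case: (eqVneq (@sbd k V X T) 0%R) => // /sbd_neq0[v vX TE].
    suff : #|X :\: T| == 1 by rewrite nXT.
    by rewrite TE setDDr setDv set0U (setIidPr _) ?sub1set // cards1.
  have vX : v \in X by have := set11 v; rewrite -XT inE => /andP[].
  have TE : T = X :\ v.
    by rewrite -XT setDDr setDv set0U; apply/esym/setIidPr.
  rewrite XT big_set1 TE sbd_setD1 // /face_sign; congr (_ ^+ _)%R.
  apply: eq_card => u; rewrite !inE.
  by case: eqVneq => [->|]; rewrite ?ltnn ?andbF.
have kmxE j : kmx k G j m = bmx (fun X Y : {set V} =>
   if [&& X \in [set X | kvalid G m X], Y \in [set X | kvalid G m X] & #|X| == j]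
   then sbd X Y else 0%R).
  by apply/matrixP => s t; rewrite !mxE !inE; apply: entry.
rewrite /betti_m /hdim /rkd -!kmxE; congr (_ - _ - _).
by apply: eq_card => X; rewrite !inE andbC.
Qed.

Section LcmMorphism.
Context {V V' : finType} (psi : mon V -> mon V').
Hypothesis psi_lcm : forall s, psi (monlcm s) = monlcm (map psi s).
Context (G : seq (mon V)) (G' : seq (mon V')).
Hypothesis inJm_psi : forall u,
  inJm G' u = has (fun g => mdiv (psi g) u) (mingens G).

Let gen (j : 'I_(size (mingens G))) : mon V := nth [ffun => 0] (mingens G) j.

Lemma has_gen (p : pred (mon V)) : has p (mingens G) = [exists j, p (gen j)].
Proof.
apply/hasP/existsP => [[g gG pg]|[j pj]]; last first.
  by exists (gen j) => //; apply: mem_nth.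
have jlt : index g (mingens G) < size (mingens G) by rewrite index_mem.
by exists (Ordinal jlt); rewrite /gen /= nth_index.
Qed.

Lemma inJm_gen u : inJm G u = [exists j, mdiv (gen j) u].
Proof.
rewrite -(has_gen (fun a => mdiv a u)); apply/hasP/hasP => -[g gG gu]; last first.
  by exists g; first apply: mingens_sub.
by have [h hG hg] := mingens_mdiv gG; exists h => //; apply: mdiv_trans gu.
Qed.

Lemma label_psi (W : finType) (g : W -> mon V) F :
  label (psi \o g) F = psi (label g F).
Proof. by rewrite /label psi_lcm -map_comp. Qed.

Lemma label_LCMset F : F != set0 -> label gen F \in LCMset G.
Proof.
move=> F0; rewrite mem_undup; apply/mapP; exists F => //.
by rewrite mem_enum inE.
Qed.

Lemma LCMset_label e : e \in LCMset G -> exists F, e = label gen F.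
Proof. by rewrite mem_undup => /mapP[F _ ->]; exists F. Qed.

(** Both sides are computed by Taylor complexes on the minimal generators of [G], labelled on the
    left by their images. The faces with image label [u] are classed by their label [e] in [G]; the
    level of a class is the total degree of [e], which drops when a boundary changes the label. *)
Lemma betti_m_psi_le i u :
  betti_m k G' i u <= \sum_(e <- LCMset G | psi e == u) betti_m k G i e.
Proof.
rewrite betti_m_hdim (@koszul_taylor k _ _ _ (psi \o gen)) => [|v]; last first.
  by rewrite inJm_psi (has_gen (fun a => mdiv (psi a) v)).
set P := [set F | _]; rewrite -big_filter.
pose lev (e : mon V) := \sum_v e v.
apply: leq_trans
  (hdim_le_blocks (cls := label gen) (lev := lev)
     (s := [seq e <- LCMset G | psi e == u]) _ _ _ _ _) _.
- move=> F H /sbd_neq0[a aF ->].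
  have le_lab := label_sub gen (subsetDl F [set a]).
  have [->|neq] := eqVneq (label gen F) (label gen (F :\ a)); first by left.
  by right; apply: mdiv_sum_lt => //; rewrite eq_sym.
- by rewrite filter_uniq // undup_uniq.
- move=> F; rewrite inE => /andP[F0 Fu].
  by rewrite mem_filter -label_psi Fu label_LCMset.
rewrite [X in X <= _]big_seq [X in _ <= X]big_seq; apply: leq_sum => e.
rewrite mem_filter => /andP[/eqP eu _].
rewrite betti_m_hdim (koszul_taylor inJm_gen) /P; apply: eq_leq; congr hdim.
apply/setP => F; rewrite !inE -andbA; congr (_ && _).
rewrite label_psi andbC; case: eqP => // ->.
by rewrite eu eqxx.
Qed.

Lemma LCMset_le_bnd e v : e \in LCMset G -> e v <= bnd G.
Proof.
case/LCMset_label => F ->; rewrite ffunE; apply/bigmax_leqP_seq => _ /mapP[j _ ->] _.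
have gG : gen j \in G by apply: mingens_sub; apply: mem_nth.
by apply: bigmax_sup_seq gG _ _ => //; apply: (leq_bigmax_cond (F := gen j)).
Qed.

Lemma betti_psi_le i : betti k G' i <= betti k G i.
Proof.
pose emb (N : nat) (U : finType) (m : {ffun U -> 'I_N}) : mon U :=
  [ffun v => val (m v)].
have emb_inj N U : injective (@emb N U).
  move=> m m' /ffunP eqm; apply/ffunP => v; apply: val_inj.
  by have := eqm v; rewrite !ffunE.
apply: (@leq_trans (\sum_(m : {ffun V' -> 'I_(bnd G').+1})
    \sum_(e <- LCMset G | psi e == emb _ _ m) betti_m k G i e)).
  by apply: leq_sum => m _; apply: betti_m_psi_le.
rewrite (exchange_big_dep xpredT) //=.
apply: (@leq_trans (\sum_(e <- LCMset G) betti_m k G i e)).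
  (* Each [e] has a single image, so it contributes to at most one multidegree [m]. *)
  apply: leq_sum => e _; rewrite sum_nat_cond_const.
  rewrite -[X in _ <= X]mul1n leq_mul2r; apply/orP; right.
  apply/card_le1_eqP => m m'; rewrite !inE => /eqP eqm /eqP.
  by rewrite eqm => /emb_inj.
(* Every [e] in [LCMset G] lies in the box summed over by [betti], hence is some [emb m]. *)
apply: (@leq_trans (\sum_(e <- LCMset G)
    \sum_(m : {ffun V -> 'I_(bnd G).+1} | emb _ _ m == e) betti_m k G i (emb _ _ m))).
  rewrite big_seq [X in _ <= X]big_seq; apply: leq_sum => e eL.
  pose m : {ffun V -> 'I_(bnd G).+1} := [ffun v => inord (e v)].
  have mE : emb _ _ m = e.
    by apply/ffunP => v; rewrite !ffunE /= inordK // ltnS LCMset_le_bnd.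
  by rewrite (bigD1 m) ?mE //= leq_addr.
rewrite (exchange_big_dep xpredT) //=; apply: leq_sum => m _.
rewrite big_const_seq iter_addn_0 -[X in _ <= X]muln1 leq_mul2l; apply/orP; right.
rewrite (eq_count (a2 := pred1 (emb _ _ m))) => [|e]; last exact: eq_sym.
by rewrite count_uniq_mem ?undup_uniq //; case: (_ \in _).
Qed.

End LcmMorphism.
End BettiNumbers.

(** * Resolutions under an lcm-preserving map *)

Section MonomialCoefficients.
Local Open Scope ring_scope.
Context {k : fieldType} {V : finType}.
Implicit Types (a b : mon V) (p q : {mpoly k[#|V|]}).

Definition multinom_of a : 'X_{1..#|V|} := [multinom a (enum_val i) | i < #|V|].

Definition mon_of (x : 'X_{1..#|V|}) : mon V := [ffun v => x (enum_rank v)].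

Lemma multinom_ofK : cancel multinom_of mon_of.
Proof. by move=> a; apply/ffunP => v; rewrite ffunE mnmE enum_rankK. Qed.

Lemma mon_ofK : cancel mon_of multinom_of.
Proof. by move=> x; apply/mnmP => i; rewrite mnmE ffunE enum_valK. Qed.

Lemma monPE a : monP k a = 'X_[multinom_of a].
Proof.
rewrite mpolyXE_id /monP (reindex _ (onW_bij _ (enum_val_bij V))) /=.
by apply: eq_bigr => i _; rewrite enum_valK mnmE.
Qed.

Definition mcoefm p a : k := p@_(multinom_of a).

Lemma mcoefmP p q : (forall a, mcoefm p a = mcoefm q a) -> p = q.
Proof. by move=> pq; apply/mpolyP => x; rewrite -(mon_ofK x); apply: pq. Qed.

Lemma mcoefm0 a : mcoefm 0 a = 0.
Proof. exact: mcoeff0. Qed.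

Lemma mcoefm_sum (I : Type) (r : seq I) (P : pred I) (F : I -> {mpoly k[#|V|]}) a :
  mcoefm (\sum_(i <- r | P i) F i) a = \sum_(i <- r | P i) mcoefm (F i) a.
Proof. exact: raddf_sum. Qed.

Lemma mcoefmZ c p a : mcoefm (c *: p) a = c * mcoefm p a.
Proof. exact: mcoeffZ. Qed.

Lemma mcoefm_monP a b : mcoefm (monP k a) b = (a == b)%:R.
Proof.
by rewrite /mcoefm monPE mcoeffX (inj_eq (can_inj multinom_ofK)).
Qed.

Lemma mcoefm_mul_monP p a b :
  mcoefm (p * monP k b) a = if mdiv b a then mcoefm p (mdiff a b) else 0.
Proof.
rewrite /mcoefm monPE; case: ifP => [/mdivP ba|nba].
  have -> : multinom_of a = (multinom_of b + multinom_of (mdiff a b))%MM.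
    by apply/mnmP => i; rewrite mnmDE !mnmE ffunE subnKC.
  exact: mcoeffMX.
apply/eqP; rewrite mcoeff_eq0 (perm_mem (msuppMX _ _)).
apply/negP => /mapP[x _ ax]; case/negP: (negbT nba); apply/mdivP => v.
have /mnmP/(_ (enum_rank v)) := ax.
by rewrite mnmDE !mnmE enum_rankK => ->; apply: leq_addr.
Qed.

Lemma mdiff_add a b : mdiv b a -> [ffun v => (mdiff a b v + b v)%N] = a.
Proof. by move=> /mdivP ba; apply/ffunP => v; rewrite !ffunE subnK. Qed.

Lemma monP_split a b : mdiv b a -> monP k a = monP k (mdiff a b) * monP k b.
Proof.
move=> ba; apply: mcoefmP => x; rewrite mcoefm_mul_monP !mcoefm_monP.
case: ifP => [bx|nbx]; last first.
  by case: eqP => // ax; rewrite -ax ba in nbx.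
case: eqP => [->|ax]; first by rewrite eqxx.
case: eqP => // /ffunP abx; case: ax; rewrite -(mdiff_add ba) -(mdiff_add bx).
by apply/ffunP => v; rewrite [LHS]ffunE [RHS]ffunE abx.
Qed.

End MonomialCoefficients.

Section MonomialIdeal.
Local Open Scope ring_scope.
Context {k : fieldType} {V : finType} (G : seq (mon V)).

Lemma inIdeal0 : inIdeal (k := k) G 0.
Proof. by exists (fun=> 0); rewrite big1 // => j _; rewrite mul0r. Qed.

Lemma inIdealD p q : inIdeal (k := k) G p -> inIdeal G q -> inIdeal G (p + q).
Proof.
move=> [c ->] [c' ->]; exists (fun j => c j + c' j).
by rewrite -big_split; apply: eq_bigr => j _; rewrite mulrDl.
Qed.

Lemma inIdeal_mul_gen p g : g \in G -> inIdeal (k := k) G (p * monP k g).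
Proof.
move=> gG; have jlt : (index g G < size G)%N by rewrite index_mem.
exists (fun j => if j == Ordinal jlt then p else 0).
rewrite (bigD1 (Ordinal jlt)) //= eqxx nth_index // big1 ?addr0 // => j /negPf->.
by rewrite mul0r.
Qed.

End MonomialIdeal.

(** * Multigraded components of homogenized chains *)

Section Multidegrees.
Local Open Scope ring_scope.
Context {k : fieldType} {V W : finType} (Delta : {set {set W}}) (lab : W -> mon V).
Implicit Types (c : chain k V W) (u : mon V).

Let schain : Type := {ffun {set W} -> k}.
Implicit Types (h : schain).

Definition scalar_sign (w : W) (F : {set W}) : k :=
  (-1) ^+ #|[set u in F | (enum_rank u < enum_rank w)%N]|.

Definition scalar_bd h : schain :=
  [ffun G => \sum_(w in ~: G) h (w |: G) * scalar_sign w (w |: G)].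

(** In degree [u] the free summand of a face [F] is the line spanned by x^(u - label F), or zero if
    the label does not divide [u]. The degree [u] part of a chain is thus a scalar chain, and
    [homogenize] is the way back. *)
Definition component u c : schain :=
  [ffun F => if mdiv (face_label lab F) u
             then mcoefm (c F) (mdiff u (face_label lab F)) else 0].

Definition homogenize u h : chain k V W :=
  [ffun F => if mdiv (face_label lab F) u
             then h F *: monP k (mdiff u (face_label lab F)) else 0].

Lemma fsignE w (F : {set W}) : fsign k V w F = (scalar_sign w F)%:MP.
Proof. by rewrite /fsign rmorphXn rmorphN1. Qed.

Lemma face_label_sub (F H : {set W}) :
  F \subset H -> mdiv (face_label lab F) (face_label lab H).
Proof. exact: label_sub. Qed.

Lemma component_bd u c : component u (bd lab c) = scalar_bd (component u c).
Proof.
apply/ffunP => G; rewrite !ffunE; case: ifP => [Gu|nGu]; last first.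
  rewrite big1 // => w _; rewrite ffunE; case: ifP => [wGu|]; last by rewrite mul0r.
  by rewrite (mdiv_trans (face_label_sub (subsetUr _ _)) wGu) in nGu.
rewrite mcoefm_sum; apply: eq_bigr => w _.
rewrite mulrA mcoefm_mul_monP ffunE.
have Gw : mdiv (face_label lab G) (face_label lab (w |: G)).
  exact: face_label_sub (subsetUr _ _).
set lG := face_label lab G in Gu Gw *; set lwG := face_label lab (w |: G) in Gw *.
have -> : mdiv (mdiff lwG lG) (mdiff u lG) = mdiv lwG u.
  apply/mdivP/mdivP => le v; have := le v; move/mdivP/(_ v): Gu; move/mdivP/(_ v): Gw;
    rewrite ![mdiff _ _ _]ffunE; move: (lG v) (lwG v) (u v) => x y z; lia.
case: ifP => [wGu|]; last by rewrite mul0r.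
have -> : mdiff (mdiff u lG) (mdiff lwG lG) = mdiff u lwG.
  apply/ffunP => v; rewrite ![mdiff _ _ _]ffunE.
  move/mdivP/(_ v): Gu; move/mdivP/(_ v): Gw.
  by move: (lG v) (lwG v) (u v) => x y z; lia.
by rewrite fsignE mulrC mul_mpolyC mcoefmZ mulrC.
Qed.

Lemma bd_homogenize u h :
  (forall F, h F != 0 -> mdiv (face_label lab F) u) ->
  bd lab (homogenize u h) = homogenize u (scalar_bd h).
Proof.
move=> hu; apply/ffunP => G; rewrite !ffunE; case: ifP => [Gu|nGu]; last first.
  rewrite big1 // => w _; rewrite ffunE; case: ifP => [wGu|]; last by rewrite mul0r.
  by rewrite (mdiv_trans (face_label_sub (subsetUr _ _)) wGu) in nGu.
rewrite scaler_suml; apply: eq_bigr => w _; rewrite ffunE.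
have [h0|/hu wGu] := eqVneq (h (w |: G)) 0.
  by rewrite h0 !mul0r !scale0r if_same mul0r.
have Gw : mdiv (face_label lab G) (face_label lab (w |: G)).
  exact: face_label_sub (subsetUr _ _).
rewrite wGu fsignE mul_mpolyC -scalerAl -scalerAr scalerA; congr (_ *: _).
set lG := face_label lab G in Gu Gw *; set lwG := face_label lab (w |: G) in wGu Gw *.
rewrite [RHS](@monP_split _ _ _ (mdiff lwG lG)).
  congr (monP _ _ * _); apply/ffunP => v; rewrite ![mdiff _ _ _]ffunE.
  move/mdivP/(_ v): wGu; move/mdivP/(_ v): Gw.
  by move: (lG v) (lwG v) (u v) => x y z; lia.
apply/mdivP => v; rewrite ![mdiff _ _ _]ffunE.
move/mdivP/(_ v): wGu; move/mdivP/(_ v): Gw.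
by move: (lG v) (lwG v) (u v) => x y z; lia.
Qed.

Lemma component_homogenize u h :
  (forall F, h F != 0 -> mdiv (face_label lab F) u) ->
  component u (homogenize u h) = h.
Proof.
move=> hu; apply/ffunP => F; rewrite ffunE; case: ifP => [Fu|nFu]; last first.
  by case: (eqVneq (h F) 0) => [->|/hu] //; rewrite nFu.
by rewrite ffunE Fu mcoefmZ mcoefm_monP eqxx mulr1.
Qed.

Lemma homogenize0 u : homogenize u 0 = 0.
Proof. by apply/ffunP => F; rewrite !ffunE scale0r if_same. Qed.

Lemma component0 u : component u 0 = 0.
Proof. by apply/ffunP => F; rewrite !ffunE mcoefm0 if_same. Qed.

Lemma bdD c c' : bd lab (c + c') = bd lab c + bd lab c'.
Proof.
apply/ffunP => F; rewrite !ffunE -big_split; apply: eq_bigr => w _.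
by rewrite ffunE mulrDl.
Qed.

Lemma bd0 : bd lab (0 : chain k V W) = 0.
Proof. by apply/ffunP => F; rewrite !ffunE big1 // => w _; rewrite ffunE mul0r. Qed.

Lemma component_neq0 u c F : component u c F != 0 ->
  mdiv (face_label lab F) u /\ c F != 0.
Proof.
rewrite ffunE; case: ifP => [_|_]; last by rewrite eqxx.
by move=> nz; split=> //; apply: contraNneq nz => ->; rewrite mcoefm0.
Qed.

Lemma homogenize_neq0 u h F : homogenize u h F != 0 ->
  mdiv (face_label lab F) u /\ h F != 0.
Proof.
rewrite ffunE; case: ifP => [_|_]; last by rewrite eqxx.
by move=> nz; split=> //; apply: contraNneq nz => ->; rewrite scale0r.
Qed.

Lemma sum_components c : exists s : seq (mon V),
  c = \sum_(u <- s) homogenize u (component u c).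
Proof.
have [supp suppP] : exists supp : {set W} -> seq (mon V),
    forall F a, mcoefm (c F) a != 0 -> a \in supp F.
  exists (fun F => [seq mon_of x | x <- msupp (c F)]) => F a.
  by rewrite /mcoefm -mcoeff_msupp => ?; rewrite -(multinom_ofK a) map_f.
(* The multidegree of x^a times the basis element of [F]. Duplicates are removed from the list so
   that each component is counted once. *)
pose raise (F : {set W}) (a : mon V) : mon V := [ffun v => (a v + face_label lab F v)%N].
exists (undup [seq raise F a | F <- enum {set W}, a <- supp F]).
apply/ffunP => F; rewrite sum_ffunE; apply: mcoefmP => a.
rewrite mcoefm_sum.
have termE u : mcoefm (homogenize u (component u c) F) a =
    if u == raise F a then mcoefm (c F) a else 0.
  rewrite ffunE; case: ifP => [Fu|nFu].
    rewrite [component _ _ F]ffunE Fu mcoefmZ mcoefm_monP; case: eqVneq => [<-|nua].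
      by rewrite /raise mdiff_add // eqxx mulr1.
    rewrite mulr0; case: eqP => // uE; case/eqP: nua; rewrite uE.
    by apply/ffunP => v; rewrite !ffunE addnK.
  rewrite mcoefm0; case: eqP => // uE; case/negP: (negbT nFu).
  by apply/mdivP => v; rewrite uE [leqRHS]ffunE leq_addl.
under eq_bigr => u _ do rewrite termE.
rewrite -big_mkcond /= big_const_seq iter_addr addr0.
rewrite (eq_count (a2 := pred1 (raise F a))) // count_uniq_mem ?undup_uniq //.
rewrite mem_undup; case: (eqVneq (mcoefm (c F) a) 0) => [->|nz].
  by rewrite mul0rn.
suff -> : raise F a \in [seq raise F a | F <- enum {set W}, a <- supp F] by [].
by apply: allpairs_f_dep; rewrite ?mem_enum // suppP.
Qed.

Lemma face_label0 : face_label lab set0 = [ffun => 0%N].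
Proof.
by apply/ffunP => v; rewrite [LHS]ffunE [RHS]ffunE /image_mem enum_set0 big_nil.
Qed.

Lemma face_label1 w : face_label lab [set w] = lab w.
Proof.
by apply/ffunP => v; rewrite ffunE /image_mem enum_set1 big_seq1.
Qed.

Lemma bd_set0 c : bd lab c set0 = aug lab c.
Proof.
rewrite ffunE setC0 /aug; apply: eq_big => [w|w _]; first by rewrite inE.
rewrite setU0 face_label1 face_label0.
have -> : mdiff (lab w) [ffun => 0%N] = lab w by apply/ffunP => v; rewrite !ffunE subn0.
rewrite /fsign (_ : [set u in _ | _] = set0) ?cards0 ?mul1r //.
by apply/setP => u; rewrite !inE; case: eqP => // ->; rewrite ltnn.
Qed.

(** The boundary at the empty face is the augmentation, and a 0-chain has no other boundary
    coefficient; the two cases of exactness thus become one. *)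
Lemma is_chain_bd_eq0 i c : is_chain Delta i c ->
  (if i is 0 then aug lab c = 0 else bd lab c = 0) <-> bd lab c = 0.
Proof.
case: i => // ch; split=> [c0|/ffunP/(_ set0)]; last by rewrite bd_set0 ffunE.
apply/ffunP => G; rewrite [RHS]ffunE; have [->|[x xG]] := set_0Vmem G.
  by rewrite bd_set0.
rewrite ffunE big1 // => w; rewrite inE => wG.
have [->|/ch/andP[_]] := eqVneq (c (w |: G)) 0; first by rewrite mul0r.
by rewrite cardsU1 wG (cardD1 x) xG.
Qed.

End Multidegrees.

Section TransferResolution.
Local Open Scope ring_scope.
Context {k : fieldType} {V V' W : finType} (psi : mon V -> mon V').
Hypothesis psi_lcm : forall s, psi (monlcm s) = monlcm (map psi s).
Context (Delta : {set {set W}}) (lab : W -> mon V).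

(** Divisibility is an lcm condition: b = lcm(a, b). *)
Lemma psi_mdiv a b : mdiv a b -> mdiv (psi a) (psi b).
Proof.
move=> ab; have -> : b = monlcm [:: a; b].
  apply: mdiv_anti; last by rewrite mdiv_monlcm /= ab mdiv_refl.
  by apply/mdivP => v; rewrite ffunE !big_cons leq_max leq_maxl orbT.
rewrite psi_lcm; apply/mdivP => v.
by rewrite [leqRHS]ffunE /= big_cons leq_maxl.
Qed.

Lemma psi_face_label F : face_label (psi \o lab) F = psi (face_label lab F).
Proof. exact: label_psi. Qed.

Definition lift_degree (u : mon V') : mon V :=
  monlcm [seq face_label lab F | F <- enum {set W} & mdiv (psi (face_label lab F)) u].

Lemma mdiv_lift_degree F u :
  mdiv (face_label lab F) (lift_degree u) = mdiv (face_label (psi \o lab) F) u.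
Proof.
rewrite psi_face_label; apply/idP/idP => [/psi_mdiv Fu|Fu].
  apply: mdiv_trans Fu _; rewrite psi_lcm mdiv_monlcm all_map.
  apply/allP => _ /mapP[H + ->].
  by rewrite mem_filter /= => /andP[].
have := mdiv_refl (lift_degree u); rewrite {1}/lift_degree mdiv_monlcm => /allP; apply.
by apply: map_f; rewrite mem_filter Fu mem_enum.
Qed.

(** The scalar boundary does not see the labels, so each component can be moved to the labels [lab]
    in the lifted degree, filled there and moved back. *)
Lemma exact_transfer i :
  (forall c : chain k V W, is_chain Delta i c -> bd lab c = 0 ->
     exists b, is_chain Delta i.+1 b /\ bd lab b = c) ->
  forall c : chain k V' W, is_chain Delta i c -> bd (psi \o lab) c = 0 ->
  exists b, is_chain Delta i.+1 b /\ bd (psi \o lab) b = c.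
Proof.
move=> exE c ch bc0; have [s cE] := sum_components (psi \o lab) c.
rewrite cE; elim: s {cE} => [|u s [b [chb bb]]].
  by exists 0; rewrite big_nil bd0; split=> // F; rewrite ffunE eqxx.
pose h := component (psi \o lab) u c.
have h_u F : h F != 0 -> mdiv (face_label lab F) (lift_degree u).
  by case/component_neq0; rewrite mdiv_lift_degree.
have [|| b' [chb' bb']] := exE (homogenize lab (lift_degree u) h).
- by move=> F /homogenize_neq0[_ /component_neq0[_ /ch]].
- by rewrite bd_homogenize // -component_bd bc0 component0 homogenize0.
(* The filling [b'] need not be homogeneous; only its component in the lifted degree is kept. *)
exists (homogenize (psi \o lab) u (component lab (lift_degree u) b') + b); split.
  move=> F; rewrite ffunE; have [->|] := eqVneq (b F) 0; last by move/chb.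
  by rewrite addr0 => /homogenize_neq0[_ /component_neq0[_ /chb']].
rewrite big_cons bdD bb; congr (_ + _); rewrite bd_homogenize.
  by rewrite -component_bd bb' component_homogenize.
by move=> F /component_neq0[]; rewrite mdiv_lift_degree.
Qed.

Lemma augmentation_image (lab' : W -> mon V') (G' : seq (mon V')) :
  is_simplicial_complex Delta ->
  (forall w, lab' w \in G') ->
  (forall g, g \in G' -> exists w, mdiv (lab' w) g) ->
  forall p : {mpoly k[#|V'|]}, inIdeal G' p <->
    exists c, is_chain Delta 0 c /\ aug lab' c = p.
Proof.
move=> [_ vertices] labG Glab p; split=> [[q ->]|[c [_ <-]]]; last first.
  apply: big_ind => [||w _]; [exact: inIdeal0|exact: inIdealD|].
  exact: inIdeal_mul_gen.
apply: (big_ind (fun p => exists c, is_chain Delta 0 c /\ aug lab' c = p)).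
- exists 0; split=> [F|]; first by rewrite ffunE eqxx.
  by rewrite /aug big1 // => w _; rewrite ffunE mul0r.
- move=> _ _ [c [ch <-]] [c' [ch' <-]]; exists (c + c'); split=> [F|].
    by rewrite ffunE; have [->|/ch //] := eqVneq (c F) 0; rewrite add0r => /ch'.
  by rewrite /aug -big_split; apply: eq_bigr => w _; rewrite ffunE mulrDl.
move=> j _; set g := nth _ _ _.
have [w wg] : exists w, mdiv (lab' w) g by apply/Glab/mem_nth.
exists [ffun F => if F == [set w] then q j * monP k (mdiff g (lab' w)) else 0].
split=> [F|]; rewrite ?ffunE.
  by case: (eqVneq F) => [-> _|_]; rewrite ?eqxx // vertices cards1.
rewrite /aug (bigD1 w) //= ffunE eqxx big1 => [|x xw]; last first.
  by rewrite ffunE (inj_eq set1_inj) (negPf xw) mul0r.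
by rewrite addr0 -mulrA -monP_split.
Qed.

Lemma supports_resolution_psi (G : seq (mon V)) (G' : seq (mon V')) :
  is_simplicial_complex Delta ->
  (forall w, psi (lab w) \in G') ->
  (forall g, g \in G' -> exists w, mdiv (psi (lab w)) g) ->
  supports_resolution k Delta lab G ->
  supports_resolution k Delta (fun w => psi (lab w)) G'.
Proof.
move=> simp labG Glab [_ exG]; split; first exact: augmentation_image.
move=> i c ch /(is_chain_bd_eq0 _ ch) bc0.
apply: (exact_transfer _ ch bc0) => c' ch' bc'0.
by apply: exG => //; apply/(is_chain_bd_eq0 lab ch').
Qed.

End TransferResolution.

(** * The map psi and the extremal ideals *)

Section ExtremalIdeals.
Context {q n : nat} (D : {set 'I_q * {set 'I_q}}) (m : 'I_q -> mon 'I_n).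

(** Each exponent of the image is one coordinate of the argument, or constantly 0, so taking maxima
    commutes with [psi]. *)
Lemma psi_monlcm s : psi m (monlcm s) = monlcm [seq psi m a | a <- s].
Proof.
apply/ffunP => x; rewrite !ffunE big_map.
case E: insub => [A|].
  by rewrite ffunE; apply: eq_bigr => a _; rewrite ffunE E.
by rewrite big1 // => a _; rewrite ffunE E.
Qed.

Hypothesis squarefree : forall j x, m j x <= 1.
Hypothesis D_lcm : forall p, p \in D -> mdiv (m p.1) (monlcm [seq m i | i in p.2]).

(** The divisibility relations enter here: if x divides m_b then x divides m_i for some i in B, so
    the set of generators divisible by x meets B. *)
Lemma inQ_Ak x : Ak m x != set0 -> inQ D (Ak m x).
Proof.
move=> A0; rewrite /inQ A0; apply/forall_inP => p pD; apply/implyP; rewrite inE => mx.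
have /mdivP/(_ x) := D_lcm pD; rewrite ffunE => /(leq_trans mx) {mx}.
rewrite big_map big_enum => /= mx.
have [i ip mi] : exists2 i, i \in p.2 & 0 < m i x.
  apply/exists_inP; apply: contraLR mx => /exists_inPn no.
  rewrite -leqNgt; apply/bigmax_leqP => i ip.
  by rewrite leqNgt no.
by apply/set0Pn; exists i; rewrite !inE mi.
Qed.

(** By [inQ_Ak] the exponent of x in the image of the i-th extremal generator is 1 or 0 according to
    whether x divides m_i, which is its exponent in the square-free m_i. *)
Lemma psi_epsX r (a : {ffun 'I_q -> 'I_r.+1}) : psi m (epsX D a) = Defs.mX m a.
Proof.
apply/ffunP => x; rewrite !ffunE; case: insubP => [A A0 AE|].
  rewrite ffunE; apply: eq_bigr => i _; congr (_ * _).
  rewrite ffunE AE inQ_Ak // inE /=.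
  by have := squarefree i x; case: (m i x) => [|[]].
rewrite negbK => /eqP/setP A0; rewrite big1 // => i _.
by have := A0 i; rewrite !inE lt0n => /negbFE/eqP->; rewrite muln0.
Qed.

Lemma Igens_psi r : Igens r m = [seq psi m g | g <- Egens r D].
Proof. by rewrite /Igens /Egens -map_comp; apply: eq_map => a /=; rewrite psi_epsX. Qed.

Lemma inJm_Igens r u :
  inJm (Igens r m) u = has (fun g => mdiv (psi m g) u) (mingens (Egens r D)).
Proof.
rewrite Igens_psi /inJm has_map; apply/hasP/hasP => -[g gE gu]; last first.
  by exists g; first apply: mingens_sub.
have [h hE hg] := mingens_mdiv gE; exists h => //.
exact: mdiv_trans (psi_mdiv psi_monlcm hg) gu.
Qed.

End ExtremalIdeals.

Unset Implicit Arguments.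
Set Strict Implicit.
Set Printing Implicit Defensive.

Theorem theorem4p4 (k : fieldType) (q n d : nat)
  (D : {set 'I_q * {set 'I_q}}) (m : 'I_q -> mon 'I_n) :
  (1 <= q)%N -> (1 <= d)%N -> #|D| = d ->
  (forall p, p \in D -> (2 <= #|p.2|)%N) ->
  (* I = (m_1, ..., m_q) is square-free with minimal generators m_1..m_q *)
  (forall j x, (m j x <= 1)%N) ->
  (forall i j, mdiv (m i) (m j) -> i = j) ->
  (forall p, p \in D -> mdiv (m p.1) (monlcm [seq m i | i in p.2])) ->
  forall r i : nat, (1 <= r)%N ->
  [/\
   (* (1) *)
   (forall (W : finType) (Delta : {set {set W}}) (lab : W -> mon (NE q)),
      is_simplicial_complex Delta ->
      injective lab ->
      (forall w, lab w \in mingens (Egens r D)) ->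
      (forall g, g \in mingens (Egens r D) -> exists w, lab w = g) ->
      supports_resolution k Delta lab (Egens r D) ->
      supports_resolution k Delta (fun w => psi m (lab w)) (Igens r m)),
   (* (2) *)
   (forall mm : mon 'I_n, mm \in LCMset (Igens r m) ->
      (betti_m k (Igens r m) i mm <=
       \sum_(e <- LCMset (Egens r D) | psi m e == mm)
          betti_m k (Egens r D) i e)%N)
   & (* (3) *)
   (betti k (Igens r m) i <= betti k (Egens r D) i)%N].
Proof.
move=> _ _ _ _ squarefree _ D_lcm r i _.
have psiE := Igens_psi squarefree D_lcm r.
split=> [W Delta lab simp _ lab_min lab_onto|mm _|].
- apply: (supports_resolution_psi (psi_monlcm m) simp).
    by move=> w; rewrite psiE map_f // mingens_sub.
  (* A generator of the power need not be minimal; a minimal one dividing it is a vertex label, and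
     [psi] preserves the divisibility. *)
  rewrite psiE => _ /mapP[g /mingens_mdiv[h /lab_onto[w <-] wg] ->].
  by exists w; apply: psi_mdiv wg; apply: psi_monlcm.
- exact (betti_m_psi_le k (psi_monlcm m) (inJm_Igens squarefree D_lcm r) i mm).
exact (betti_psi_le k (psi_monlcm m) (inJm_Igens squarefree D_lcm r) i).
Qed.
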